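(* Let $E$ and $F$ be separable symmetric sequence spaces and let $1\le p,q\le\infty$, with $p^*$ defined by $\frac1p+\frac1{p^*}=1$. (i) If $E$ is $p$-concave and $F$ is $q$-concave, where $p\ne\infty$, $q\ne\infty$ and $q\le p^*$, then the injective tensor product $E\widehat{\widehat{\otimes}}F$ is not isomorphic to any subspace of a Banach space with an unconditional basis. (ii) If $E$ is $p$-convex and $F$ is $q$-convex, where $p\ne1$, $q\ne1$ and $p^*\le q$, then the projective tensor product $E\widehat{\otimes}F$ is not isomorphic to any subspace of a Banach space with an unconditional basis.
   Context: Sequences have entries in a fixed field $\mathbb K$ ($\mathbb R$ or $\mathbb C$). $c_0$ is the space of sequences converging to zero; for $x\in c_0$, $|x|=(|x_i|)_{i\ge1}$ and $x^*$ is the non-increasing rearrangement of $|x|$. A symmetric sequence space is a linear subspace $E\subset c_0$ with a complete norm such that: (i) if $y\in E$, $x\in c_0$ and $|x|\le|y|$ coordinatewise, then $x\in E$ and $\|x\|\le\|y\|$; (ii) if $x\in E$, $x'\in c_0$ and $(x')^*=x^*$, then $x'\in E$ and $\|x'\|=\|x\|$; normalised so that $\|(1,0,0,\dots)\|=1$. $E$ is $p$-convex ($1\le p\le\infty$) if there is $C>0$ with $\|(\sum_{k=1}^n|x_k|^p)^{1/p}\|_E\le C(\sum_{k=1}^n\|x_k\|_E^p)^{1/p}$ for all finite families $x_1,\dots,x_n\in E$, and $q$-concave ($1\le q\le\infty$) if there is $C>0$ with $(\sum_{k=1}^n\|x_k\|_E^q)^{1/q}\le C\|(\sum_{k=1}^n|x_k|^q)^{1/q}\|_E$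 for all such families (operations coordinatewise; maxima replace sums when the exponent is $\infty$). For Banach spaces $E,F$, the projective norm on the algebraic tensor product $E\otimes F$ is $\pi(u)=\inf\{\sum_{i=1}^n\|x_i\|_E\|y_i\|_F: u=\sum_{i=1}^n x_i\otimes y_i\}$, and the injective norm of $u=\sum_{i=1}^n x_i\otimes y_i$ is $\varepsilon(u)=\sup\{|\sum_{i=1}^n\varphi(x_i)\psi(y_i)|:\varphi\in E^*,\|\varphi\|\le1,\psi\in F^*,\|\psi\|\le1\}$. $E\widehat{\otimes}F$ and $E\widehat{\widehat{\otimes}}F$ are the completions of $E\otimes F$ with respect to $\pi$ and $\varepsilon$, respectively. *)

(* Defs.v *)
From HB Require Import structures.
From mathcomp Require Import all_boot all_order all_algebra.
From mathcomp Require Import complex.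
From mathcomp Require Import all_classical all_reals all_analysis.

Set Implicit Arguments.
Unset Strict Implicit.
Unset Printing Implicit Defensive.

Import Order.TTheory GRing.Theory Num.Theory.
Import numFieldNormedType.Exports.

Local Open Scope classical_set_scope.
Local Open Scope card_scope.
Local Open Scope ring_scope.

Variant scalar_kind := RealScalars | ComplexScalars.

Definition scalar (R : realType) (k : scalar_kind) : numFieldType :=
  match k with RealScalars => R | ComplexScalars => R[i]%C end.

Definition scalar_re (R : realType) (k : scalar_kind) : scalar R k -> R :=
  match k with
  | RealScalars => fun x => x
  | ComplexScalars => @complex.Re R
  end.

Definition scalar_of_real (R : realType) (k : scalar_kind) : R -> scalar R k :=
  match k with
  | RealScalars => fun x => x
  | ComplexScalars => fun x => (x%:C)%C
  end.

Section Definitions.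
Context {R : realType} {k : scalar_kind}.
Local Notation K := (scalar R k).

(* In a [normedModType K] the norm takes its values in the scalar field [K],
   hence in [R[i]] for complex spaces; [rnorm] is the same norm with values
   in [R]. *)
Definition rnorm {V : normedZmodType K} (x : V) : R := scalar_re `|x|.

Definition separable (T : topologicalType) : Prop :=
  exists2 D : set T, countable D & dense D.

Definition in_c0 (x : nat -> K) : Prop := x @ \oo --> (0 : K).

(* [decr_rearr x n] is the (n+1)-st largest of the |x_i|, counted with
   multiplicity: the least t >= 0 such that at most n indices i satisfy
   |x_i| > t.  Thus, for x in c_0, zero entries of x are dropped when x has
   infinite support, and zeros are appended when it has finite support. *)
Definition decr_rearr (x : nat -> K) (n : nat) : R :=
  inf [set t : R | 0 <= t /\ [set i | t < rnorm (x i)] #<= `I_n].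

(* The subspace E of c_0 with its complete norm is presented as a Banach space
   [sss_space] together with its inclusion [coord] into the sequences;
   "x belongs to E" reads "x = coord z for some z : E". *)
Record symmetric_sequence_space := SymmetricSequenceSpace {
  sss_space :> completeNormedModType K;
  coord : sss_space -> nat -> K;
  coord_linear : forall (a : K) (x y : sss_space) (i : nat),
    coord (a *: x + y) i = a * coord x i + coord y i;
  coord_inj : injective coord;
  coord_c0 : forall x : sss_space, in_c0 (coord x);
  sss_solid : forall (y : sss_space) (x : nat -> K), in_c0 x ->
    (forall i, `|x i| <= `|coord y i|) ->
    exists2 z : sss_space, coord z = x & `|z| <= `|y|;
  sss_symmetric : forall (x : sss_space) (x' : nat -> K), in_c0 x' ->
    decr_rearr x' = decr_rearr (coord x) ->
    exists2 z : sss_space, coord z = x' & `|z| = `|x|;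
  sss_normalised :
    exists2 e : sss_space, coord e = (fun i => (i == 0%N)%:R) & `|e| = 1 }.

Definition lp_comb (p : \bar R) (n : nat) (a : 'I_n -> R) : R :=
  match p with
  | r%:E => (\sum_(j < n) a j `^ r) `^ r^-1
  | +oo%E => \big[Num.max/0]_(j < n) a j
  | -oo%E => 0
  end.

(* [z] is the element (sum_j |x_j|^p)^(1/p) of E; it exists by solidity, since
   this sequence is dominated by sum_j |x_j|, and it is unique. *)
Definition is_lattice_comb (E : symmetric_sequence_space) (p : \bar R) (n : nat)
    (x : 'I_n -> E) (z : E) : Prop :=
  forall i, coord z i = scalar_of_real k (lp_comb p (fun j => rnorm (coord (x j) i))).

Definition p_convex (E : symmetric_sequence_space) (p : \bar R) : Prop :=
  exists2 C : R, 0 < C & forall (n : nat) (x : 'I_n -> E) (z : E),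
    is_lattice_comb p x z -> rnorm z <= C * lp_comb p (fun j => rnorm (x j)).

Definition q_concave (E : symmetric_sequence_space) (q : \bar R) : Prop :=
  exists2 C : R, 0 < C & forall (n : nat) (x : 'I_n -> E) (z : E),
    is_lattice_comb q x z -> lp_comb q (fun j => rnorm (x j)) <= C * rnorm z.

Record algebraic_tensor_product (E F : lmodType K) := AlgebraicTensorProduct {
  tensor_space :> lmodType K;
  tensor : {bilinear E -> F -> tensor_space};
  tensor_universal : forall (Z : lmodType K) (f : {bilinear E -> F -> Z}),
    exists g : {linear tensor_space -> Z},
      (forall x y, g (tensor x y) = f x y) /\
      (forall g' : {linear tensor_space -> Z},
         (forall x y, g' (tensor x y) = f x y) -> g' =1 g) }.

(* |phi(x)| <= ||x|| for all x says that phi is continuous with norm <= 1. *)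
Definition in_dual_ball (E : normedModType K) (phi : {scalar E}) : Prop :=
  forall x : E, `|phi x| <= `|x|.

Definition projective_norm (E F : normedModType K)
    (W : algebraic_tensor_product E F) (u : W) : R :=
  inf [set s : R | exists (n : nat) (x : 'I_n -> E) (y : 'I_n -> F),
    u = \sum_(j < n) tensor W (x j) (y j) /\
    s = \sum_(j < n) rnorm (x j) * rnorm (y j)].

(* The sum of the phi(x_j) psi(y_j) does not depend on the representation of
   [u], so that letting it vary does not change the supremum. *)
Definition injective_norm (E F : normedModType K)
    (W : algebraic_tensor_product E F) (u : W) : R :=
  sup [set s : R | exists (n : nat) (x : 'I_n -> E) (y : 'I_n -> F)
      (phi : {scalar E}) (psi : {scalar F}),
    [/\ u = \sum_(j < n) tensor W (x j) (y j), in_dual_ball phi,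
        in_dual_ball psi & s = rnorm (\sum_(j < n) phi (x j) * psi (y j))]].

Record completion (V : lmodType K) (N : V -> R) := Completion {
  completion_space :> completeNormedModType K;
  completion_map : {linear V -> completion_space};
  completion_isometry : forall v : V, rnorm (completion_map v) = N v;
  completion_dense : dense (range completion_map) }.

Definition schauder_basis (X : normedModType K) (b : nat -> X) : Prop :=
  forall x : X, exists! a : nat -> K, series (fun n => a n *: b n) @ \oo --> x.

Definition unconditional_basis (X : normedModType K) (b : nat -> X) : Prop :=
  schauder_basis b /\
  forall (x : X) (a : nat -> K), series (fun n => a n *: b n) @ \oo --> x ->
  forall s : nat -> nat, bijective s ->
    series (fun n => a (s n) *: b (s n)) @ \oo --> x.

Definition isomorphic_to_subspace (T X : normedModType K) : Prop :=
  exists (J : {linear T -> X}) (c C : K), [/\ 0 < c, 0 < C &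
    forall t : T, c * `|t| <= `|J t| <= C * `|t| ].

Definition embeds_in_unconditional (T : normedModType K) : Prop :=
  exists (X : completeNormedModType K) (b : nat -> X),
    unconditional_basis b /\ isomorphic_to_subspace T X.

End Definitions.

Arguments symmetric_sequence_space R k : clear implicits.

(* Main.v *)
(* Let e_i, f_j be the unit vectors of E and F. If the tensor product embeds
   into a space X with an unconditional basis, a gliding hump argument
   provides pairs r_1, c_1, r_2, c_2, ... of indices such that, with d_i =
   e_{r_i.1} - e_{r_i.2} and d'_j = f_{c_j.1} - f_{c_j.2}, the vectors d_i (x)
   d'_j that become available when r_n (resp. c_n) is chosen lie almost in one
   block of the basis, these blocks being disjoint. (Differences and the
   pigeonhole principle replace weak nullity of the unit vectors, which fails
   in l_1.) Hence the main triangle projection is bounded on the matrices sum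
   a_ij d_i (x) d'_j. This is refuted on [0, 2^m)^2 by the dyadic substitute a
   = sum_I h_I (x) 1_I / |I| of the Hilbert matrix: on l_P x l_Q with 1/P +
   1/Q = 1 and P >= 2 its norm is at most m^(1 - 1/P), by Clarkson's
   inequality and Young's inequality, whereas its upper triangle sums to m 2^m
   / 4. Averaging over cyclic shifts, concavity (resp. convexity) compares the
   norms of E and F on 2^m coordinates with those of l_P and l_Q. *)

Require Import Defs.
From HB Require Import structures.
From mathcomp Require Import all_boot all_order all_algebra.
From mathcomp Require Import complex ring lra zify.
From mathcomp Require Import all_classical all_reals all_analysis.

Set Implicit Arguments.
Unset Strict Implicit.
Unset Printing Implicit Defensive.

Import Order.TTheory GRing.Theory Num.Theory.
Import numFieldNormedType.Exports.

Local Open Scope classical_set_scope.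
Local Open Scope card_scope.
Local Open Scope ring_scope.

(** The pairs of indices delivered by the gliding hump depend on the matrix and on the tolerance and
    cannot be prescribed. Every norm estimate is therefore made uniform over all families of
    disjoint pairs, which is where the symmetry of the norms enters. The two tensor norms use the
    dyadic matrix on opposite sides of a duality. For the injective norm it gives the coefficients
    of the tested tensor, which is bounded above by evaluating the form at pairs of functionals,
    while its triangle is bounded below by functionals that average coordinates. For the projective
    norm the tested tensor is the elementary one with all coefficients 1, and the dyadic matrix acts
    as a bilinear form that detects its triangle. Concavity bounds norms above by l_P means and
    convexity bounds them below, so p, q are first replaced by real conjugate exponents lying above,
    respectively below, them. The gain over the trivial factor m comes from the Haar differences of
    a vector: by Clarkson's inequality the m levels share a single l_P norm. *)

(** * Real and complex scalars, real-valued norms *)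

Section Scalars.
Context {R : realType} {k : scalar_kind}.
Local Notation K := (Defs.scalar R k).
Local Notation r2s := (@scalar_of_real R k).
Local Notation s2r := (@scalar_re R k).

Lemma scalar_of_realK (x : R) : s2r (r2s x) = x.
Proof. by case: k. Qed.

Lemma scalar_of_realD x y : r2s (x + y) = r2s x + r2s y.
Proof. by case: k => //; apply/eqP; rewrite eq_complex /= addr0 !eqxx. Qed.

Lemma scalar_of_realM x y : r2s (x * y) = r2s x * r2s y.
Proof. by case: k => //; apply/eqP; rewrite eq_complex /= !(mul0r, mulr0) subr0 addr0 !eqxx. Qed.

Lemma scalar_of_realN x : r2s (- x) = - r2s x.
Proof. by case: k => //; apply/eqP; rewrite eq_complex /= oppr0 !eqxx. Qed.

Lemma scalar_of_real0 : r2s 0 = 0.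
Proof. by case: k. Qed.

Lemma scalar_of_real1 : r2s 1 = 1.
Proof. by case: k. Qed.

Lemma scalar_of_real_sum (I : Type) (s : seq I) (P : pred I) (f : I -> R) :
  r2s (\sum_(i <- s | P i) f i) = \sum_(i <- s | P i) r2s (f i).
Proof.
apply: (big_morph _ scalar_of_realD); exact: scalar_of_real0.
Qed.

Lemma ler_scalar_of_real x y : (r2s x <= r2s y) = (x <= y).
Proof. by case: k => //=; rewrite lecR. Qed.

Lemma ltr_scalar_of_real x y : (r2s x < r2s y) = (x < y).
Proof. by case: k => //=; rewrite ltcR. Qed.

(** In [R[i]] only numbers with equal imaginary parts are comparable, so a nonnegative scalar is
    real. *)
Lemma ger0_scalar (a : K) : 0 <= a -> a = r2s (s2r a).
Proof. by case: k a => //= -[u v]; rewrite lecE /= => /andP[/eqP-> _]. Qed.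

Section Norm.
Context {V : normedZmodType K}.
Implicit Types x y : V.

Lemma normr_rnorm x : `|x| = r2s (rnorm x).
Proof. by rewrite /rnorm -ger0_scalar. Qed.

Lemma rnorm_ge0 x : 0 <= rnorm x.
Proof. by rewrite -ler_scalar_of_real scalar_of_real0 -normr_rnorm. Qed.

Lemma rnorm0 : rnorm (0 : V) = 0.
Proof. by rewrite /rnorm normr0 -scalar_of_real0 scalar_of_realK. Qed.

Lemma rnorm_eq0 x : (rnorm x == 0) = (x == 0).
Proof.
by rewrite -[x == 0]normr_eq0 normr_rnorm !eq_le -!ler_scalar_of_real scalar_of_real0.
Qed.

Lemma rnorm_gt0 x : (0 < rnorm x) = (x != 0).
Proof. by rewrite lt_def rnorm_eq0 rnorm_ge0 andbT. Qed.

Lemma rnormN x : rnorm (- x) = rnorm x.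
Proof. by rewrite /rnorm normrN. Qed.

Lemma rnormD x y : rnorm (x + y) <= rnorm x + rnorm y.
Proof.
by rewrite -ler_scalar_of_real scalar_of_realD -!normr_rnorm ler_normD.
Qed.

Lemma rnormB x y : rnorm (x - y) <= rnorm x + rnorm y.
Proof. by rewrite -(rnormN y) rnormD. Qed.

Lemma rnorm_distC x y : rnorm (x - y) = rnorm (y - x).
Proof. by rewrite -rnormN opprB. Qed.

Lemma rnorm_distD z x y : rnorm (x - y) <= rnorm (x - z) + rnorm (z - y).
Proof. by rewrite (le_trans _ (rnormD _ _))// addrA subrK. Qed.

Lemma rnorm_sum (I : Type) (s : seq I) (P : pred I) (f : I -> V) :
  rnorm (\sum_(i <- s | P i) f i) <= \sum_(i <- s | P i) rnorm (f i).
Proof.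
elim/big_ind2: _ => [|x a y b xa yb|//]; first by rewrite rnorm0.
by rewrite (le_trans (rnormD _ _)) ?lerD.
Qed.

End Norm.

Lemma ler_rnorm (V W : normedZmodType K) (x : V) (y : W) :
  (`|x| <= `|y|) = (rnorm x <= rnorm y).
Proof. by rewrite !normr_rnorm ler_scalar_of_real. Qed.

Lemma rnormZ (V : normedModType K) (a : K) (x : V) :
  rnorm (a *: x) = rnorm a * rnorm x.
Proof.
by rewrite {1}/rnorm normrZ !normr_rnorm -scalar_of_realM scalar_of_realK.
Qed.

Lemma rnormM (a b : K) : rnorm (a * b) = rnorm a * rnorm b.
Proof.
by rewrite {1}/rnorm normrM !normr_rnorm -scalar_of_realM scalar_of_realK.
Qed.

Lemma rnorm_scalar_of_real (x : R) : rnorm (r2s x) = `|x|.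
Proof.
wlog x0 : x / 0 <= x => [hw|].
  case: (leP 0 x) => [/hw //|/ltW x0].
  by rewrite -rnormN -scalar_of_realN hw ?oppr_ge0// normrN.
rewrite /rnorm ger0_norm ?scalar_of_realK ?ger0_norm//.
by rewrite -scalar_of_real0 ler_scalar_of_real.
Qed.

Lemma rnorm1 : rnorm (1 : K) = 1.
Proof. by rewrite -scalar_of_real1 rnorm_scalar_of_real normr1. Qed.

Lemma rnormV (a : K) : rnorm a^-1 = (rnorm a)^-1.
Proof.
have [->|a0] := eqVneq a 0; first by rewrite invr0 rnorm0 invr0.
apply: (mulfI (x := rnorm a)); first by rewrite rnorm_eq0.
by rewrite -rnormM !divff ?rnorm_eq0// rnorm1.
Qed.

Lemma parallelogram (a b : K) :
  rnorm (a + b) ^+ 2 + rnorm (a - b) ^+ 2 = 2 * (rnorm a ^+ 2 + rnorm b ^+ 2).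
Proof.
case: k a b => /= a b; rewrite /rnorm /=; first by rewrite !real_normK ?num_real//; ring.
case: a b => [a a'] [b b'].
rewrite !sqr_sqrtr ?addr_ge0 ?sqr_ge0//; ring.
Qed.

Lemma cvg_rnorm (V : normedModType K) (u : nat -> V) (x : V) :
  u @ \oo --> x <->
  (forall e : R, 0 < e -> exists N, forall n, (N <= n)%N -> rnorm (u n - x) < e).
Proof.
split=> [/cvgrPdist_lt h e e0|h].
  have e0' : 0 < r2s e by rewrite -scalar_of_real0 ltr_scalar_of_real.
  have [N _ hN] := h _ e0'; exists N => n /hN /=.
  by rewrite normr_rnorm ltr_scalar_of_real rnorm_distC.
apply/cvgrPdist_lt => e e0; rewrite (ger0_scalar (ltW e0)).
have /h [N hN] : 0 < s2r e.
  by rewrite -ltr_scalar_of_real -ger0_scalar ?ltW// scalar_of_real0.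
exists N => // n /hN; by rewrite normr_rnorm ltr_scalar_of_real rnorm_distC.
Qed.

Lemma rnorm_complete (V : completeNormedModType K) (u : nat -> V) :
  (forall e : R, 0 < e ->
     exists N, forall n m, (N <= n)%N -> (N <= m)%N -> rnorm (u n - u m) < e) ->
  exists x : V, u @ \oo --> x.
Proof.
move=> h; suff : cvgn u by move=> uc; exists (limn u).
apply: cauchy_cvg; apply: cauchy_exP => e e0.
have /h [N hN] : 0 < s2r e.
  by rewrite -ltr_scalar_of_real -ger0_scalar ?ltW// scalar_of_real0.
exists (u N); exists N => // n /= Nn; rewrite -ball_normE /ball_ /=.
by rewrite normr_rnorm (ger0_scalar (ltW e0)) ltr_scalar_of_real hN.
Qed.

End Scalars.

(** * Baire's theorem and Zabreiko's lemma *)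

Section UniformBoundedness.
Context {R : realType} {k : scalar_kind}.
Local Notation K := (Defs.scalar R k).

Lemma exp2V_small (e : R) : 0 < e -> exists N, 2 ^- N < e.
Proof.
move=> e0; exists (Num.truncn e^-1).+1; rewrite -[ltRHS]invrK ltf_pV2 ?posrE ?invr_gt0//.
apply: lt_le_trans (truncnS_gt _) _.
by rewrite -natrX ler_nat ltnW // ltn_expl.
Qed.

(** Baire's theorem for sets that need not be closed: one of them is dense in some ball. Otherwise
    every ball contains a smaller one at positive distance from a given [F m], and the common point
    of a nested sequence of such balls is covered by none of the sets. *)
Lemma baire_cover (X : completeNormedModType K) (F : nat -> set X) :
  (forall x, exists m, F m x) ->
  exists m x0 (d : R), 0 < d /\ forall y, rnorm (y - x0) < d ->
    forall e : R, 0 < e -> exists2 z, F m z & rnorm (y - z) < e.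
Proof.
move=> cover; apply: contrapT => nodense.
have step (t : nat * (X * R)) : exists s' : X * R, 0 < t.2.2 ->
    [/\ 0 < s'.2, s'.2 <= t.2.2 / 2, rnorm (s'.1 - t.2.1) + s'.2 <= t.2.2 &
        forall z, F t.1 z -> s'.2 < rnorm (s'.1 - z)].
  case: t => m [x0 d] /=; have [d0|] := ltP 0 d; last by exists (x0, d).
  apply: contrapT => nos; apply: nodense; exists m, x0, d; split=> // y yd e e0.
  apply: contrapT => noz; apply: nos.
  (* The three bounds keep the new ball away from [F m], halve the radius, and keep the ball inside
     the old one. *)
  pose d' := Num.min (e / 2) (Num.min (d / 2) (d - rnorm (y - x0))).
  exists (y, d') => _ /=; split.
  - by rewrite !lt_min !divr_gt0//= subr_gt0.
  - by rewrite !ge_min lexx orbT.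
  - by rewrite -lerBrDl !ge_min lexx !orbT.
  - move=> z Fz; rewrite ltNge; apply/negP => h; apply: noz; exists z => //.
    apply: (le_lt_trans h); rewrite gt_min ltr_pdivrMr ?ltr_pMr//.
    by rewrite ltrDl ltr01.
have [f fP] := choice step.
pose st := fix st n := if n is m.+1 then f (m, st m) else (0 : X, 1 : R).
have st0 n : 0 < (st n).2 by elim: n => //= n IH; case: (fP (n, st n) IH).
have st2 n : (st n).2 <= 2 ^- n.
  elim: n => [|n IH]; first by rewrite expr0 invr1.
  have [_ h _ _] := fP (n, st n) (st0 n); apply: (le_trans h) => /=.
  by rewrite exprS invfM mulrC ler_pM2l ?invr_gt0.
have near n m : (n <= m)%N -> rnorm ((st m).1 - (st n).1) + (st m).2 <= (st n).2.
  move=> /subnK <-; elim: (m - n)%N => [|j IH]; first by rewrite subrr rnorm0 add0r.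
  have [_ _ h _] := fP ((j + n)%N, st (j + n)%N) (st0 _).
  apply: le_trans IH => /=; rewrite -/(st (j + n)%N) in h *.
  apply: le_trans (lerD (rnorm_distD (st (j + n)%N).1 _ _) (lexx _)) _.
  by rewrite addrAC [leRHS]addrC lerD.
have [x xlim] : exists x : X, (fun n => (st n).1) @ \oo --> x.
  apply: rnorm_complete => e e0.
  have [N hN] : exists N, 2 ^- N < e / 2 by apply: exp2V_small; rewrite divr_gt0.
  have aux n : (N <= n)%N -> rnorm ((st n).1 - (st N).1) < e / 2.
    move=> /near h; apply: le_lt_trans hN; apply: le_trans (st2 N).
    by apply: le_trans h; rewrite lerDl ltW.
  exists N => n m /aux hn /aux hm; apply: le_lt_trans (rnorm_distD (st N).1 _ _) _.
  by rewrite [ltRHS]splitr ltrD// rnorm_distC.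
have [m Fm] := cover x.
have [_ _ _ /(_ x Fm)] := fP (m, st m) (st0 m).
rewrite -/(st m.+1) ltNge => /negP; apply; apply/ler_addgt0Pr => e e0.
have [N hN] := (cvg_rnorm _ _).1 xlim e e0.
pose M := maxn N m.+1.
apply: le_trans (rnorm_distD (st M).1 _ _) _; apply: lerD.
  rewrite rnorm_distC; apply: le_trans (near m.+1 M (leq_maxr _ _)).
  by rewrite lerDl ltW.
by rewrite ltW// hN ?leq_maxl.
Qed.

(** Zabreiko's lemma: a countably subadditive seminorm on a Banach space is continuous. By Baire
    some sublevel set of [p] is dense in a ball, so every vector can be approximated at a cost
    proportional to its norm; it is then the sum of successive approximations with geometrically
    decreasing costs. *)
Lemma zabreiko (X : completeNormedModType K) (p : X -> R) :
  (forall x, 0 <= p x) ->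
  (forall x y, p (x + y) <= p x + p y) ->
  (forall (a : K) x, p (a *: x) = rnorm a * p x) ->
  (forall (y : nat -> X) x s, series y @ \oo --> x ->
     (forall n, \sum_(0 <= i < n) p (y i) <= s) -> p x <= s) ->
  exists2 C : R, 0 < C & forall x, p x <= C * rnorm x.
Proof.
move=> p0 pD pZ pS.
have [x|m [x0 [d [d0 dense]]]] := @baire_cover X (fun m => [set x | p x <= m%:R]).
  by exists (Num.truncn (p x)).+1; exact/ltW/truncnS_gt.
have pN x : p (- x) = p x by rewrite -scaleN1r pZ rnormN rnorm1 mul1r.
have p00 : p 0 = 0 by rewrite -(scale0r (0 : X)) pZ rnorm0 mul0r.
(* Differences of points near the centre [x0] move the ball to 0 and double the bound m. *)
have approx0 y (e : R) : rnorm y < d -> 0 < e ->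
    exists2 z, p z <= 2 * m%:R & rnorm (y - z) < e.
  move=> yd e0; have e20 : 0 < e / 2 by rewrite divr_gt0.
  have [|z pz zy] := dense (x0 + y) _ _ e20; first by rewrite addrAC subrr add0r.
  have [|w pw wx] := dense x0 _ _ e20; first by rewrite subrr rnorm0.
  exists (z - w).
    by rewrite (le_trans (pD _ _))// pN mulr2n mulrDl mul1r lerD.
  have -> : y - (z - w) = (x0 + y - z) - (x0 - w).
    rewrite !opprB [x0 + y]addrC -!addrA; congr (_ + _).
    by rewrite [x0 + (_ + _)]addrC -addrA subrK addrC.
  by rewrite [ltRHS]splitr (le_lt_trans (rnormB _ _))// ltrD.
have [c c0 approx] : exists2 c : R, 0 < c &
    forall y (e : R), 0 < e -> exists2 z, p z <= c * rnorm y & rnorm (y - z) < e.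
  (* Rescaling [y] to norm d / 2 turns the bound 2 m into 4 m / d times the norm of [y]; [m.+1]
     keeps the constant positive. *)
  exists (4 * m.+1%:R / d); first by rewrite divr_gt0// mulr_gt0.
  move=> y e e0; have [->|y0] := eqVneq y 0.
    exists 0; last by rewrite subr0 rnorm0.
    by rewrite p00 rnorm0 mulr0.
  have ny : 0 < rnorm y by rewrite rnorm_gt0.
  pose t : R := d / 2 / rnorm y.
  have t0 : 0 < t by rewrite !divr_gt0.
  pose a : K := scalar_of_real k t.
  have na : rnorm a = t by rewrite rnorm_scalar_of_real gtr0_norm.
  have a0 : a != 0 by rewrite -rnorm_gt0 na.
  have [||z pz zy] := approx0 (a *: y) (t * e).
  - by rewrite rnormZ na /t divfK ?gt_eqF// ltr_pdivrMr// ltr_pMr// ltrDl ltr01.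
  - exact: mulr_gt0.
  - exists (a^-1 *: z).
      rewrite pZ rnormV na ler_pdivrMl// (le_trans pz)//.
      have -> : t * (4 * m.+1%:R / d * rnorm y) = 2 * m.+1%:R.
        by rewrite /t; field; rewrite gt_eqF//= gt_eqF.
      by rewrite ler_pM2l// ler_nat.
    rewrite -(ltr_pM2l t0); apply: le_lt_trans zy.
    by rewrite -na -rnormZ scalerBr scalerA divff// scale1r.
exists (2 * c) => [|y]; first exact: mulr_gt0.
have [->|y0] := eqVneq y 0.
  by rewrite p00 rnorm0 mulr0.
have ny : 0 < rnorm y by rewrite rnorm_gt0.
have step (t : nat * X) : exists z, p z <= c * rnorm t.2 /\
    rnorm (t.2 - z) < rnorm y * 2 ^- t.1.+1.
  have e0 : 0 < rnorm y * 2 ^- t.1.+1 by rewrite mulr_gt0// invr_gt0 exprn_gt0.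
  by have [z ? ?] := approx t.2 _ e0; exists z.
have [f fP] := choice step.
(* [r n] is what is left of [y] after n approximations; its norm is at most 2^-n times that of [y],
   so the costs [p (z n)] sum to at most 2 c times the norm of [y]. *)
pose r := fix r n := if n is m.+1 then r m - f (m, r m) else y.
pose z n := f (n, r n).
have rle n : rnorm (r n) <= rnorm y * 2 ^- n.
  case: n => [|n]; first by rewrite expr0 invr1 mulr1.
  by have [_ /ltW] := fP (n, r n).
have sumz n : series z n = y - r n.
  rewrite /series /=; elim: n => [|n IH]; first by rewrite big_geq// subrr.
  by rewrite big_nat_recr//= IH opprB addrA [RHS]addrAC addrC.
apply: (pS z) => [|n].
  apply/cvg_rnorm => e e0.
  have [N hN] : exists N, 2 ^- N < e / rnorm y by apply: exp2V_small; rewrite divr_gt0.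
  exists N => n Nn; rewrite sumz addrAC subrr add0r rnormN.
  apply: (le_lt_trans (rle n)); rewrite mulrC -ltr_pdivlMr//.
  by apply: le_lt_trans hN; rewrite lef_pV2 ?posrE ?exprn_gt0// ler_weXn2l// ler1n.
apply: (@le_trans _ _ (2 * c * rnorm y * (1 - 2 ^- n))); last first.
  rewrite ler_piMr ?mulr_ge0 ?ltW// gerBl invr_ge0 exprn_ge0//.
elim: n => [|n IH]; first by rewrite big_geq// expr0 invr1 subrr mulr0.
rewrite big_nat_recr//=; have [pz _] := fP (n, r n).
apply: (le_trans (lerD IH (le_trans pz (ler_wpM2l (ltW c0) (rle n))))).
rewrite exprS invfM; set u := (2 ^- n).
by rewrite le_eqVlt; apply/orP; left; apply/eqP; field.
Qed.

End UniformBoundedness.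

(** * Partial sums of an unconditionally convergent series *)

Section UnconditionalBasis.
Context {R : realType} {k : scalar_kind}.
Local Notation K := (Defs.scalar R k).

Lemma nondecreasing_bounded_cauchy (f : nat -> R) (M : R) :
  (forall n, f n <= f n.+1) -> (forall n, f n <= M) ->
  forall e : R, 0 < e -> exists N, forall n, (N <= n)%N -> f n - f N < e.
Proof.
move=> fS fM e e0; have hs : has_sup (range f).
  by split; [exists (f 0%N), 0%N | exists M => _ [n _ <-]].
have [_ [N _ <-] hN] := sup_adherent e0 hs; exists N => n _.
have := ub_le_sup (proj2 hs) (imageP f (I : setT n)); lra.
Qed.

Lemma real_complete (u : nat -> R) :
  (forall e : R, 0 < e ->
     exists N, forall n m, (N <= n)%N -> (N <= m)%N -> `|u n - u m| < e) ->
  exists l : R, forall e : R, 0 < e ->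
    exists N, forall n, (N <= n)%N -> `|u n - l| < e.
Proof.
move=> h; have /cvg_ex [l ul] : cvgn u.
  apply: cauchy_cvg; apply: cauchy_exP => e /h [N hN].
  by exists (u N), N => // n /= Nn; exact: hN.
exists l => e e0; move/cvgrPdist_lt: ul => /(_ e e0) [N _ hN].
by exists N => n /hN /=; rewrite distrC.
Qed.

Lemma scalar_complete (t : nat -> K) :
  (forall e : R, 0 < e ->
     exists N, forall n m, (N <= n)%N -> (N <= m)%N -> rnorm (t n - t m) < e) ->
  exists l : K, t @ \oo --> l.
Proof.
case: k t => [t|t] h.
  have [l hl] := real_complete h.
  by exists l; apply/(@cvg_rnorm R RealScalars).
have nRe (z : R[i]) : `|complex.Re z| <= rnorm (z : Defs.scalar R ComplexScalars).
  by case: z => x y; rewrite /rnorm /= -sqrtr_sqr ler_wsqrtr// lerDl sqr_ge0.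
have nIm (z : R[i]) : `|complex.Im z| <= rnorm (z : Defs.scalar R ComplexScalars).
  by case: z => x y; rewrite /rnorm /= -sqrtr_sqr ler_wsqrtr// lerDr sqr_ge0.
have [a ha] : exists l : R, forall e : R, 0 < e ->
    exists N, forall n, (N <= n)%N -> `|complex.Re (t n) - l| < e.
  apply: real_complete => e /h [N hN]; exists N => n m Nn Nm.
  by rewrite -raddfB (le_lt_trans (nRe _))// hN.
have [c hc] : exists l : R, forall e : R, 0 < e ->
    exists N, forall n, (N <= n)%N -> `|complex.Im (t n) - l| < e.
  apply: real_complete => e /h [N hN]; exists N => n m Nn Nm.
  by rewrite -raddfB (le_lt_trans (nIm _))// hN.
exists (a +i* c)%C; apply/(@cvg_rnorm R ComplexScalars) => e e0.
have e20 : 0 < e / 2 by rewrite divr_gt0.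
have [N1 h1] := ha _ e20; have [N2 h2] := hc _ e20.
exists (maxn N1 N2) => n; rewrite geq_max => /andP[/h1 n1 /h2 n2].
have n12 := ltrD n1 n2; rewrite -splitr in n12; apply: le_lt_trans n12.
have -> : t n - (a +i* c)%C = ((complex.Re (t n) - a)%:C + 'i * (complex.Im (t n) - c)%:C)%C.
  by case: (t n) => x y; apply/eqP; rewrite eq_complex /=; apply/andP; split; apply/eqP; ring.
apply: (le_trans (@rnormD R ComplexScalars _ _ _)).
rewrite (@rnormM R ComplexScalars).
rewrite !(@rnorm_scalar_of_real R ComplexScalars) lerD2l.
have -> : rnorm ('i%C : Defs.scalar R ComplexScalars) = 1.
  by rewrite /rnorm normCi.
by rewrite mul1r.
Qed.

Section Permutation.
Context {X : normedModType K} (v : nat -> X) (x : X).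
Hypothesis vx : forall s : nat -> nat, bijective s ->
  series (v \o s) @ \oo --> x.

(* If the finite partial sums were unbounded, each block [m, N) with N large
   would contain a partial sum of norm > 1; listing these partial sums first in
   successive blocks gives a rearrangement that is not Cauchy. *)
Lemma unconditional_partial_sums_bounded :
  exists M : R, forall (P : pred nat) N,
    rnorm (\sum_(0 <= n < N | P n) v n) <= M.
Proof.
apply: contrapT => unb.
have le_all (P : pred nat) a b : rnorm (\sum_(a <= n < b | P n) v n) <=
    \sum_(a <= n < b) rnorm (v n).
  apply: (le_trans (rnorm_sum _ _ _)); rewrite big_mkcond ler_sum// => i _.
  by case: (P i); rewrite ?rnorm_ge0.
have tail m : exists PN : pred nat * nat, (m < PN.2)%N /\
    1 < rnorm (\sum_(m <= n < PN.2 | PN.1 n) v n).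
  apply: contrapT => not; apply: unb.
  exists (1 + \sum_(0 <= n < m) rnorm (v n)) => P N.
  have [Nm|mN] := leqP N m.
    apply: (le_trans (le_all _ _ _)).
    rewrite [in leRHS](big_cat_nat (leq0n N) Nm)//= addrCA lerDl addr_ge0//.
    by apply: sumr_ge0 => i _; exact: rnorm_ge0.
  rewrite (big_cat_nat (leq0n m) (ltnW mN))//= (le_trans (rnormD _ _))// addrC lerD//.
  rewrite leNgt; apply/negP => h; apply: not; exists (P, N); split=> //.
have [f fP] := choice tail.
pose M := fix M j := if j is i.+1 then (f (M i)).2 else 0%N.
have MS j : (M j < M j.+1)%N by have [] := fP (M j).
have Mlt i j : (i < j)%N -> (M i < M j)%N.
  elim: j => // j IH; rewrite ltnS leq_eqVlt => /predU1P[->//|/IH h].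
  exact: ltn_trans h (MS j).
have Mmono i j : (i <= j)%N -> (M i <= M j)%N.
  by rewrite leq_eqVlt => /predU1P[->//|/Mlt/ltnW].
have Mge j : (j <= M j)%N by elim: j => // j IH; exact: leq_ltn_trans IH (MS j).
have blex n : exists j, (M j <= n < M j.+1)%N.
  elim: n => [|n [j /andP[j1 j2]]].
    by exists 0%N; exact: (MS 0%N).
  have [h|h] := ltnP n.+1 (M j.+1).
    by exists j; rewrite h (leq_trans j1).
  by exists j.+1; rewrite h (leq_ltn_trans j2 (MS j.+1)).
have [bl blP] := choice blex.
have blE j n : (M j <= n < M j.+1)%N -> bl n = j.
  move=> /andP[j1 j2]; have /andP[b1 b2] := blP n; apply/eqP.
  rewrite eqn_leq; apply/andP; split; rewrite leqNgt; apply/negP => /Mmono h.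
    by have := leq_ltn_trans b1 j2; rewrite ltnNge h.
  by have := leq_ltn_trans j1 b2; rewrite ltnNge h.
pose good j := [seq n <- index_iota (M j) (M j.+1) | (f (M j)).1 n].
pose L j := good j ++ [seq n <- index_iota (M j) (M j.+1) | predC (f (M j)).1 n].
have Lperm j : perm_eq (L j) (index_iota (M j) (M j.+1)).
  by rewrite /L perm_filterC.
have Lsize j : size (L j) = (M j.+1 - M j)%N by rewrite (perm_size (Lperm j)) size_iota.
have Luniq j : uniq (L j) by rewrite (perm_uniq (Lperm j)) iota_uniq.
have Lmem j y : (y \in L j) = (M j <= y < M j.+1)%N.
  by rewrite (perm_mem (Lperm j)) mem_index_iota.
(* The rearrangement permutes each block, reading the list [L j] from position [M j] on. *)
pose s n := nth 0%N (L (bl n)) (n - M (bl n)).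
have off n : (n - M (bl n) < size (L (bl n)))%N.
  by rewrite Lsize; have /andP[? ?] := blP n; rewrite ltn_sub2r// (leq_ltn_trans _ (MS _)).
have bls n : bl (s n) = bl n by apply: blE; rewrite -Lmem mem_nth.
have sinj : injective s.
  move=> n n' e; have eb : bl n = bl n' by rewrite -bls e bls.
  have := off n; have := off n'; rewrite -eb => o' o.
  move/eqP: e; rewrite /s -eb nth_uniq//.
  have /andP[h1 _] := blP n; have /andP[h2 _] := blP n'.
  by move=> /eqP h; rewrite -(subnK h1) h eb subnK.
have ssurj y : exists n, s n = y.
  have yL : y \in L (bl y) by rewrite Lmem blP.
  exists (M (bl y) + index y (L (bl y)))%N.
  have e : bl (M (bl y) + index y (L (bl y)))%N = bl y.
    apply: blE; rewrite leq_addr/=; have := index_mem y (L (bl y)).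
    by rewrite yL Lsize ltn_subRL.
  by rewrite /s e addKn nth_index.
have [g gP] := choice ssurj.
have sbij : bijective s by exists g => // n; apply: sinj; rewrite gP.
have /cvg_rnorm/(_ _ (ltr01 : 0 < 1 :> R)) := vx sbij.
have h20 : 0 < 1 / 2 :> R by rewrite divr_gt0.
have /cvg_rnorm/(_ _ h20) [N hN _] := vx sbij.
(* The first [q] terms of block [N] are the selected ones, so the partial sums at [M N] and
   [M N + q], both past [N], differ by a vector of norm greater than 1. *)
pose q := size (good N).
have qle : (q <= M N.+1 - M N)%N by rewrite -Lsize size_cat leq_addr.
have /hN h1 : (N <= M N)%N by [].
have /hN h2 : (N <= M N + q)%N by rewrite (leq_trans (Mge N))// leq_addr.
have [_] := fP (M N).
have -> : \sum_(M N <= n < (f (M N)).2 | (f (M N)).1 n) v n =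
   series (v \o s) (M N + q)%N - series (v \o s) (M N).
  rewrite /series /= (big_cat_nat (leq0n (M N)) (leq_addr q (M N)))//=.
  rewrite addrAC subrr add0r -big_filter -/(good N) (big_nth 0%N) -/q.
  have -> : \sum_(M N <= i < M N + q) v (s i) = \sum_(0 <= i < q) v (s (i + M N)%N).
    by rewrite -{1}[M N]add0n big_addn addKn.
  rewrite big_nat [RHS]big_nat.
  apply: eq_bigr => i /andP[_ iq].
  have e : bl (i + M N)%N = N.
    by apply: blE; rewrite leq_addl/= addnC -ltn_subRL (leq_trans iq qle).
  by rewrite /s e addnK nth_cat -/q iq.
apply/negP; rewrite -leNgt; apply: (le_trans (rnorm_distD x _ _)).
by rewrite [leRHS]splitr ltW// ltrD// rnorm_distC.
Qed.

End Permutation.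
End UnconditionalBasis.

(** * Uniform bound for the projections of an unconditional basis *)

Section BasisProjections.
Context {R : realType} {k : scalar_kind}.
Local Notation K := (Defs.scalar R k).
Context {X : completeNormedModType K} (b : nat -> X).
Hypothesis ub : unconditional_basis b.

Definition basis_coef (x : X) : nat -> K :=
  projT1 (cid (proj1 ub x)).

Local Notation c := basis_coef.

(** The cut-off [N] keeps every sum finite; bounds uniform in [P] and [N] stand in for the infinite
    projections. *)
Definition basis_proj (P : pred nat) (N : nat) (x : X) : X :=
  \sum_(0 <= n < N | P n) c x n *: b n.

Local Notation Q := basis_proj.

Lemma basis_coef_cvg x : series (fun n => c x n *: b n) @ \oo --> x.
Proof. by rewrite /c; case: cid => a []. Qed.

Lemma basis_coef_unique x a : series (fun n => a n *: b n) @ \oo --> x -> a = c x.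
Proof. by rewrite /c; case: cid => a' /= [_ h] /h. Qed.

Lemma basis_coefD (a : K) x y n : c (a *: x + y) n = a * c x n + c y n.
Proof.
rewrite -(@basis_coef_unique _ (fun n => a * c x n + c y n))//.
have -> : series (fun n => (a * c x n + c y n) *: b n) =
    (fun N => a *: series (fun n => c x n *: b n) N + series (fun n => c y n *: b n) N).
  apply/funext => N; rewrite /series /= scaler_sumr -big_split /=.
  by apply: eq_bigr => i _; rewrite scalerDl scalerA.
by apply: cvgD; [apply: cvgZl_tmp|]; exact: basis_coef_cvg.
Qed.

Lemma basis_coefB x y n : c (x - y) n = c x n - c y n.
Proof. by rewrite addrC -scaleN1r basis_coefD mulN1r addrC. Qed.

Lemma basis_projD P N (a : K) x y : Q P N (a *: x + y) = a *: Q P N x + Q P N y.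
Proof.
rewrite /Q scaler_sumr -big_split; apply: eq_bigr => i _ /=.
by rewrite basis_coefD scalerDl scalerA.
Qed.

Lemma basis_proj0 P N : Q P N 0 = 0.
Proof.
have := basis_projD P N 1 0 0; rewrite !scale1r addr0 => /eqP.
by rewrite eq_sym -subr_eq0 addrK => /eqP.
Qed.

Lemma basis_projZ P N (a : K) x : Q P N (a *: x) = a *: Q P N x.
Proof. by have := basis_projD P N a x 0; rewrite basis_proj0 !addr0. Qed.

Lemma basis_projDr P N x y : Q P N (x + y) = Q P N x + Q P N y.
Proof. by have := basis_projD P N 1 x y; rewrite !scale1r. Qed.

Lemma basis_projB P N x y : Q P N (x - y) = Q P N x - Q P N y.
Proof. by rewrite -scaleN1r basis_projDr basis_projZ scaleN1r. Qed.

Lemma basis_proj_sum P N (I : Type) (s : seq I) (f : I -> X) :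
  Q P N (\sum_(i <- s) f i) = \sum_(i <- s) Q P N (f i).
Proof. by apply: (big_morph _ (basis_projDr P N) (basis_proj0 P N)). Qed.

Lemma basis_neq0 n : b n != 0.
Proof.
apply/negP => /eqP b0.
have e (a : nat -> K) : (forall i, i != n -> a i = 0) -> a = c 0.
  move=> a0; apply: basis_coef_unique.
  rewrite (_ : series _ = fun=> 0); first exact: cvg_cst.
  apply/funext => N; rewrite /series /= big1// => i _.
  by have [->|/a0 ->] := eqVneq i n; rewrite ?b0 ?scaler0 ?scale0r.
have h0 : (fun=> 0) = c 0 by apply: e.
have h1 : (fun i => (i == n)%:R) = c 0 by apply: e => i /negbTE ->.
have /(congr1 (fun f => f n)) := etrans h0 (esym h1).
by rewrite eqxx => /eqP; rewrite eq_sym oner_eq0.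
Qed.

Let orbit x := [set t | exists P N, t = rnorm (Q P N x)].
(** Finite because the partial sums are bounded. The coefficients are not known to be continuous at
    this point; Zabreiko's lemma for this seminorm gives their continuity and the uniform bound
    together. *)
Let p x := sup (orbit x).

Let orbit_sup x : has_sup (orbit x).
Proof.
split; first by exists (rnorm (Q xpredT 0%N x)), xpredT, 0%N.
have [M hM] := @unconditional_partial_sums_bounded _ _ _
  (fun n => c x n *: b n) x (proj2 ub x (c x) (@basis_coef_cvg x)).
by exists M => _ [P [N ->]]; exact: hM.
Qed.

Let pge P N x : rnorm (Q P N x) <= p x.
Proof. by apply: ub_le_sup; [case: (orbit_sup x)|exists P, N]. Qed.

Let ple x t : (forall P N, rnorm (Q P N x) <= t) -> p x <= t.
Proof.
by move=> h; apply: ge_sup; [case: (orbit_sup x)|move=> _ [P [N ->]]; exact: h].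
Qed.

Let p_ge0 x : 0 <= p x.
Proof. exact: le_trans (rnorm_ge0 _) (pge xpredT 0 x). Qed.

Let pD x y : p (x + y) <= p x + p y.
Proof.
apply: ple => P N; rewrite basis_projDr (le_trans (rnormD _ _))// lerD//.
Qed.

Let pZ (a : K) x : p (a *: x) = rnorm a * p x.
Proof.
have le (d : K) y : p (d *: y) <= rnorm d * p y.
  apply: ple => P N; rewrite basis_projZ rnormZ ler_wpM2l ?rnorm_ge0//.
apply/eqP; rewrite eq_le le/=; have [->|a0] := eqVneq a 0.
  by rewrite rnorm0 mul0r.
have na : 0 < rnorm a by rewrite rnorm_gt0.
rewrite -ler_pdivlMl// -rnormV; apply: le_trans (le _ _).
by rewrite scalerA mulVf// scale1r.
Qed.

(** The projections of the partial sums of [y] are Cauchy uniformly in the index set and the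
    cut-off, so their coefficients converge. The limits are coefficients of an expansion of [x],
    hence those of [x] by uniqueness, and the bound passes to the limit. *)
Let p_series (y : nat -> X) x s : series y @ \oo --> x ->
  (forall n, \sum_(0 <= i < n) p (y i) <= s) -> p x <= s.
Proof.
move=> yx ys.
pose S := fun n => \sum_(0 <= i < n) p (y i).
have SC := @nondecreasing_bounded_cauchy _ S s.
have {}SC e : 0 < e -> exists N, forall n m, (N <= n)%N -> (n <= m)%N ->
    p (series y m - series y n) <= e.
  move=> /SC [||N hN] // => [n|]; first by rewrite /S big_nat_recr//= lerDl.
  exists N => n m Nn nm; rewrite /series /= (big_cat_nat (leq0n n) nm)/=.
  rewrite addrAC subrr add0r.
  have h : S m - S N <= e by rewrite ltW// hN// (leq_trans Nn).
  apply: le_trans h; rewrite /S (big_cat_nat (leq0n N) (leq_trans Nn nm))/=.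
  rewrite addrAC subrr add0r (big_cat_nat Nn nm)/= ler_wpDl ?sumr_ge0//.
  elim/big_ind2: _ => // [|a u d v au dv]; last exact: le_trans (pD _ _) (lerD au dv).
  by rewrite -(scale0r (0 : X)) pZ rnorm0 mul0r.
have QC e : 0 < e -> exists N, forall n m, (N <= n)%N -> (N <= m)%N -> forall P B,
    rnorm (Q P B (series y m) - Q P B (series y n)) <= e.
  move=> /SC [N hN]; exists N => n m Nn Nm P B.
  wlog nm : n m Nn Nm / (n <= m)%N => [hw|].
    by have [/hw|/ltnW/hw] := leqP n m; [exact|rewrite rnorm_distC; exact].
  by rewrite -basis_projB (le_trans (pge _ _ _))// hN.
have aex n : exists l : K, (fun L => c (series y L) n) @ \oo --> l.
  apply: scalar_complete => e e0.
  have bn : 0 < rnorm (b n) by rewrite rnorm_gt0 basis_neq0.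
  have /QC [N hN] : 0 < e / 2 * rnorm (b n) by rewrite mulr_gt0// divr_gt0.
  exists N => i j Ni Nj; have := hN j i Nj Ni (pred1 n) n.+1.
  have Q1 x' : Q (pred1 n) n.+1 x' = c x' n *: b n.
    by rewrite /Q big_mkcond/= big_nat_recr//= eqxx big_nat big1 ?add0r// => l /andP[_ ln]; rewrite ltn_eqF.
  rewrite !Q1 -scalerBl rnormZ ler_pM2r// => h; apply: (le_lt_trans h).
  by rewrite ltr_pdivrMr// ltr_pMr// ltrDl ltr01.
have [a ha] := choice aex.
have Qlim P B : (fun L => Q P B (series y L)) @ \oo --> \sum_(0 <= n < B | P n) a n *: b n.
  by apply: cvg_big => [|i _]; [exact: add_continuous|apply: cvgZr_tmp; exact: ha].
have Qnear e : 0 < e -> exists N, forall n, (N <= n)%N -> forall P B,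
    rnorm (\sum_(0 <= n < B | P n) a n *: b n - Q P B (series y n)) <= e.
  move=> /QC [N hN]; exists N => n Nn P B; apply/ler_addgt0Pr => e' e'0.
  have [N' hN'] := (cvg_rnorm _ _).1 (Qlim P B) _ e'0.
  have h := hN n (maxn N N') Nn (leq_maxl _ _) P B.
  rewrite [leRHS]addrC; apply: le_trans (rnorm_distD (Q P B (series y (maxn N N'))) _ _) _.
  by rewrite lerD// rnorm_distC ltW// hN'// leq_maxr.
have ax : a = c x.
  apply: basis_coef_unique; apply/cvg_rnorm => e e0.
  have e4 : 0 < e / 4 by rewrite divr_gt0.
  have [N1 h1] := Qnear _ e4.
  have [N2 h2] := (cvg_rnorm _ _).1 yx _ e4.
  pose n := maxn N1 N2.
  have [N3 h3] := (cvg_rnorm _ _).1 (@basis_coef_cvg (series y n)) _ e4.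
  exists N3 => m /h3 {}h3.
  have {}h1 := h1 n (leq_maxl _ _) xpredT m; have {}h2 := h2 n (leq_maxr _ _).
  have t1 := rnorm_distD (Q xpredT m (series y n))
    (series (fun n => a n *: b n) m) x.
  have t2 := rnorm_distD (series y n) (Q xpredT m (series y n)) x.
  rewrite /Q in t1 t2 h1; rewrite /series /= in t1 t2 h1 h2 h3 *; lra.
apply: ple => P B; apply/ler_addgt0Pr => e /Qnear [N hN].
have := hN N (leqnn _) P B; rewrite ax -/(Q P B x) => h.
have t1 := rnorm_distD (Q P B (series y N)) (Q P B x) 0; rewrite !subr0 in t1.
have t2 : rnorm (Q P B (series y N)) <= s.
  apply: (le_trans (pge _ _ _)); apply: le_trans (ys N).
  rewrite /series /=; elim/big_ind2: _ => // [|d u d' v du dv].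
    by rewrite -(scale0r (0 : X)) pZ rnorm0 mul0r.
  exact: le_trans (pD _ _) (lerD du dv).
lra.
Qed.

Lemma basis_proj_bounded :
  exists2 C : R, 0 < C & forall P N x, rnorm (Q P N x) <= C * rnorm x.
Proof.
have [C C0 hC] := zabreiko p_ge0 pD pZ p_series.
by exists C => // P N x; apply: le_trans (hC x).
Qed.

End BasisProjections.

(** * Pigeonhole principle for bounded families of scalars *)

Section Pigeonhole.
Context {R : realType}.

(** The cell of an index records the integer part of (g l i + B) / e for each l. There are finitely
    many cells, so two indices from [i0] on share one. *)
Lemma pigeonhole_real (I : finType) (g : I -> nat -> R) (B e : R) (i0 : nat) :
  0 < e -> (forall l i, `|g l i| <= B) ->
  exists i j, (i0 <= i)%N /\ (i < j)%N /\ forall l, `|g l i - g l j| <= e.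
Proof.
move=> e0 gB.
pose M := Num.truncn ((B + B) / e).
pose T := {ffun I -> 'I_M.+1}.
pose h (i : nat) : T := [ffun l => inord (Num.truncn ((g l i + B) / e))].
have hP i j : h i = h j -> forall l, `|g l i - g l j| <= e.
  move=> hij l; have := congr1 (fun u : T => val (u l)) hij; rewrite !ffunE.
  have ge0 i' : 0 <= (g l i' + B) / e.
    by apply: divr_ge0; [have := gB l i'; rewrite ler_norml; lra|exact: ltW].
  have le i' : (Num.truncn ((g l i' + B) / e) < M.+1)%N.
    rewrite ltnS le_truncn// ler_pM2r ?invr_gt0// lerD2r.
    exact: le_trans (ler_norm _) (gB _ _).
  rewrite /= !inordK// => E.
  have := truncn_itv (ge0 i); have := truncn_itv (ge0 j); rewrite E.
  set t := Num.truncn _; rewrite -natr1 => /andP[a1 a2] /andP[b1 b2].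
  have : `|(g l i + B) / e - (g l j + B) / e| <= 1 by rewrite ler_norml; lra.
  rewrite -mulrBl (_ : g l i + B - (g l j + B) = g l i - g l j); last by ring.
  by rewrite normrM [`|e^-1|]gtr0_norm ?invr_gt0// ler_pdivrMr// mul1r.
have /injectivePn [x [y xy hxy]] : ~~ injectiveb (fun i : 'I_#|T|.+1 => h (i0 + i)%N).
  apply/negP => /injectiveP /leq_card; by rewrite card_ord ltnn.
have [lt|lt|/val_inj E] := ltngtP x y; last by rewrite E eqxx in xy.
- exists (i0 + x)%N, (i0 + y)%N; rewrite leq_addr ltn_add2l lt; do 2 split=> //.
  exact: hP.
- exists (i0 + y)%N, (i0 + x)%N; rewrite leq_addr ltn_add2l lt; do 2 split=> //.
  by apply: hP.
Qed.

Lemma pigeonhole_scalar (k : scalar_kind) (I : finType)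
    (g : I -> nat -> Defs.scalar R k) (B e : R) (i0 : nat) :
  0 < e -> (forall l i, rnorm (g l i) <= B) ->
  exists i j, (i0 <= i)%N /\ (i < j)%N /\ forall l, rnorm (g l i - g l j) <= e.
Proof.
case: k g => [g|g] e0 gB; first exact: (@pigeonhole_real I g B e i0).
(* Real and imaginary parts count as separate coordinates; the two errors e / 2 add up. *)
pose h (l : I * bool) i := if l.2 then complex.Re (g l.1 i) else complex.Im (g l.1 i).
have [|l i|i [j [ij0 [ij hij]]]] := @pigeonhole_real _ h B (e / 2) i0.
- by rewrite divr_gt0.
- apply: le_trans (gB l.1 i); rewrite /h; case: (g l.1 i) => x y; case: l.2.
    by rewrite /rnorm /= -sqrtr_sqr ler_wsqrtr// lerDl sqr_ge0.
  by rewrite /rnorm /= -sqrtr_sqr ler_wsqrtr// lerDr sqr_ge0.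
exists i, j; do 2 (split=> //); move=> l.
have := lerD (hij (l, true)) (hij (l, false)); rewrite -splitr; apply: le_trans.
rewrite /h /= -!raddfB; case: (g l i - g l j) => x y; rewrite /rnorm /=.
rewrite -[leRHS]ger0_norm ?addr_ge0// -sqrtr_sqr ler_wsqrtr//.
rewrite sqrrD !real_normK ?num_real// lerD2r lerDl mulrn_wge0// mulr_ge0.
Qed.

End Pigeonhole.

(** * The gliding hump *)

Section GlidingHump.
Context {R : realType} {k : scalar_kind}.
Local Notation K := (Defs.scalar R k).
Context {X : completeNormedModType K} {b : nat -> X}.
Variable ub : unconditional_basis b.
Local Notation Q := (basis_proj ub).
Local Notation c := (basis_coef ub).

Lemma basis_coef_finite (a : nat -> K) M n :
  c (\sum_(0 <= i < M) a i *: b i) n = if (n < M)%N then a n else 0.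
Proof.
rewrite -(@basis_coef_unique _ _ _ _ ub _ (fun n => if (n < M)%N then a n else 0))//.
apply/cvg_rnorm => e e0; exists M => N MN.
rewrite /series /= (big_cat_nat (leq0n M) MN)/= [X in _ + X - _]big_nat.
rewrite [X in _ + X - _]big1 ?addr0 => [|i /andP[Mi _]]; last by rewrite ltnNge Mi scale0r.
rewrite (@eq_big_nat _ _ _ _ _ _ (fun i => a i *: b i)) => [|i /andP[_ ->]//].
by rewrite subrr rnorm0.
Qed.

Lemma basis_proj_widen (P : pred nat) M N x : (forall n, P n -> (n < M)%N) -> (M <= N)%N ->
  Q P N x = Q P M x.
Proof.
move=> PM MN; rewrite /basis_proj (big_cat_nat (leq0n M) MN)/= [X in _ + X]big_nat_cond.
rewrite [X in _ + X]big1 ?addr0// => i /andP[/andP[Mi _] /PM]; by rewrite ltnNge Mi.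
Qed.

Lemma basis_projID (A P : pred nat) N x :
  Q P N x = Q (fun n => P n && A n) N x + Q (fun n => P n && ~~ A n) N x.
Proof. by rewrite /basis_proj (bigID A). Qed.

Section Bound.
Variable C : R.
Hypothesis C0 : 0 < C.
Hypothesis QC : forall P N x, rnorm (Q P N x) <= C * rnorm x.

(** A projection onto indices from [M'] on annihilates the first [M'] terms, so it sees only the
    remainder of [x]; taking this below e / C absorbs the norm of the projection. *)
Lemma basis_proj_tail x (e : R) : 0 < e ->
  exists M, forall M', (M <= M')%N -> rnorm (x - Q xpredT M' x) <= e /\
  forall (P : pred nat) N, (forall n, P n -> (M' <= n)%N) -> rnorm (Q P N x) <= e.
Proof.
move=> e0; pose d := Num.min e (e / C).
have d0 : 0 < d by rewrite lt_min e0 divr_gt0.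
have [M hM] := (cvg_rnorm _ _).1 (@basis_coef_cvg _ _ _ _ ub x) _ d0.
exists M => M' /hM; rewrite rnorm_distC -/(Q xpredT M' x) => /ltW hd.
split; first by rewrite (le_trans hd)// ge_min lexx.
move=> P N PM; have -> : Q P N x = Q P N (x - Q xpredT M' x).
  rewrite basis_projB [X in _ - X](_ : _ = 0) ?subr0//.
  rewrite /basis_proj big1// => n Pn; rewrite basis_coef_finite ltnNge PM//.
  by rewrite scale0r.
apply: (le_trans (QC _ _ _)); rewrite mulrC -ler_pdivlMr//.
by rewrite (le_trans hd)// ge_min lexx orbT.
Qed.

(** One stage of the construction. The pigeonhole principle for the first [M] coefficients, weighted
    by the norms of the basis vectors, makes the differences almost vanish there for all l at once;
    [M'] is then taken past all their tails. *)
Lemma gliding_step (I : finType) (z : I -> nat -> X) (B e : R) (M i0 : nat) :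
  0 < e -> (forall l i, rnorm (z l i) <= B) ->
  exists i j M', [/\ (i0 <= i)%N, (i < j)%N, (M <= M')%N & forall l,
    let v := z l i - z l j in
    [/\ forall (P : pred nat) N, (forall n, P n -> (n < M)%N) -> rnorm (Q P N v) <= e,
        rnorm (v - Q xpredT M' v) <= e &
        forall (P : pred nat) N, (forall n, P n -> (M' <= n)%N) -> rnorm (Q P N v) <= e]].
Proof.
move=> e0 zB.
pose g (t : I * 'I_M) i := scalar_of_real k (rnorm (b t.2)) * c (z t.1 i) t.2.
(* At most [M] coefficients contribute, so their errors sum to at most e. *)
have [||i [j [i0i [ij hij]]]] := @pigeonhole_scalar R k _ g (C * B) (e / M.+1%:R) i0.
- by rewrite divr_gt0.
- move=> [l n] i; rewrite /g /= rnormM rnorm_scalar_of_real ger0_norm ?rnorm_ge0//.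
  rewrite mulrC -rnormZ; apply: (@le_trans _ _ (C * rnorm (z l i))); last first.
    by rewrite ler_pM2l.
  have := QC (pred1 (n : nat)) n.+1 (z l i); congr (rnorm _ <= _).
  rewrite /basis_proj big_mkcond big_nat_recr//= eqxx big_nat big1 ?add0r//.
  by move=> m /andP[_ mn]; rewrite ltn_eqF.
have tail l := basis_proj_tail (z l i - z l j) e0.
have [F FP] := choice tail.
pose M' := \max_l F l.
exists i, j, (maxn M M'); split=> //; first exact: leq_maxl.
move=> l v.
have [F1 F2] : rnorm (v - Q xpredT (maxn M M') v) <= e /\ forall (P : pred nat) N,
    (forall n, P n -> (maxn M M' <= n)%N) -> rnorm (Q P N v) <= e.
  by apply: FP; rewrite leq_max leq_bigmax orbT.
split=> // P N PM; rewrite /basis_proj (eq_bigl (fun n => P n && (n < M)%N)); last first.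
  by move=> n; case: (boolP (P n)) => // /PM ->.
apply: (le_trans (rnorm_sum _ _ _)).
apply: (@le_trans _ _ (\sum_(0 <= n < N | (n < M)%N) (e / M.+1%:R))).
  rewrite big_mkcond [leRHS]big_mkcond/=; apply: ler_sum => n _.
  case: (ltnP n M) => nM; rewrite ?andbF// andbT.
  case: ifP => _; last by rewrite divr_ge0// ltW.
  apply: le_trans (hij (l, Ordinal nM)); rewrite /g /=.
  by rewrite -mulrBr rnormM rnorm_scalar_of_real ger0_norm ?rnorm_ge0//
       mulrC -basis_coefB rnormZ.
rewrite -big_filter big_const_seq count_predT iter_addr_0 -[leLHS]mulr_natr.
rewrite mulrAC ler_pdivrMr// ler_wpM2l ?(ltW e0)// ler_nat.
have /uniq_leq_size h : uniq [seq n <- index_iota 0 N | (n < M)%N].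
  by rewrite filter_uniq// iota_uniq.
apply: (leq_trans (h (index_iota 0 M.+1) _)); last by rewrite size_iota subn0.
by move=> n; rewrite mem_filter !mem_index_iota /= => /andP[/ltnW].
Qed.

Variables (Y : nat -> nat -> X) (B : R).
Hypothesis YB : forall i j, rnorm (Y i j) <= B.

(** When [Y i j] is the image of e_i (x) f_j under a linear map, this is the image of (e_{p.1} -
    e_{p.2}) (x) (f_{q.1} - f_{q.2}). *)
Definition second_difference (p q : nat * nat) : X :=
  (Y p.1 q.1 - Y p.2 q.1) - (Y p.1 q.2 - Y p.2 q.2).

Local Notation D := second_difference.

(* Rows are chosen at the even stages and columns at the odd ones.  The block of
   basis vectors between the values of [M] at two consecutive stages carries,
   up to [e], the vectors that appear at that stage; [A] collects the blocks of
   the odd stages. *)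
Lemma gliding_hump (e : R) (T : nat) : 0 < e ->
  exists (p : nat -> nat * nat) (H M : nat) (A : pred nat),
  [/\ forall s, (s < T)%N -> ((p s).1 < (p s).2 < H)%N,
      forall s t, (s < t)%N -> (t < T)%N -> ((p s).2 < (p t).1)%N &
      forall s t, (s < T)%N -> (t < T)%N -> ~~ odd s -> odd t ->
      forall (P : pred nat) N, (forall n, (n < M)%N -> P n = A n) -> (M <= N)%N ->
      rnorm (Q P N (D (p s) (p t)) - (if (s < t)%N then D (p s) (p t) else 0))
        <= 4 * e].
Proof.
move=> e0; elim: T => [|T [p [H [M [A [pH plt pQ]]]]]].
  by exists (fun=> (0, 0)%N), 0%N, 0%N, xpred0.
(* Only the new index varies, a column at odd stages and a row at even ones; the other factor is a
   pair chosen before. *)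
pose z (s : 'I_T) i := if odd T then Y (p s).1 i - Y (p s).2 i
                       else Y i (p s).1 - Y i (p s).2.
have zB l i : rnorm (z l i) <= B + B.
  by rewrite /z; case: ifP => _; rewrite (le_trans (rnormB _ _))// lerD.
have [i [j [M' [Hi ij MM' hv]]]] := gliding_step M H e0 zB.
pose p' s := if s == T then (i, j) else p s.
have p'T : p' T = (i, j) by rewrite /p' eqxx.
have p'p s : (s < T)%N -> p' s = p s by rewrite /p' => /ltn_eqF ->.
pose A' n := if (n < M)%N then A n else odd T.
exists p', j.+1, M', A'; split.
- move=> s; rewrite ltnS leq_eqVlt => /predU1P[->|sT].
    by rewrite p'T /= ij ltnS leqnn.
  rewrite p'p//; have /andP[-> h] := pH s sT.
  by rewrite /= ltnS ltnW// (leq_trans h)// (leq_trans Hi)// ltnW.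
- move=> s t st; rewrite ltnS leq_eqVlt => /predU1P[tT|tT].
    rewrite tT in st *; rewrite p'T p'p//=; have /andP[_ h] := pH s st.
    exact: leq_trans h Hi.
  by rewrite !p'p ?(ltn_trans st)// plt.
(* The estimate is claimed for every [P] that continues [A], so enlarging the projection preserves
   the earlier estimates. *)
have PM'M (P : pred nat) : (forall n, (n < M')%N -> P n = A' n) ->
    forall n, (n < M)%N -> P n = A n.
  by move=> PA n nM; rewrite PA ?(leq_trans nM)// /A' nM.
move=> s t; rewrite !ltnS leq_eqVlt => /predU1P[->|sT].
  rewrite leq_eqVlt => /predU1P[-> /negbTE-> //|tT eT ot P N PA MN].
  (* New row: its block is left out of [A'], and the projection is small, by e for the indices below
     [M] and by e for those from [M'] on. *)
  rewrite p'T p'p// ltnNge (ltnW tT)/= subr0.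
  have [] := hv (Ordinal tT); rewrite /z (negbTE eT)/=.
  rewrite (_ : _ - _ = D (i, j) (p t)); last by rewrite /D /= !opprB addrACA [- _ + _]addrC -addrACA.
  set v := D _ _ => v1 v2 v3.
  rewrite (basis_projID (fun n => n < M)%N) (le_trans (rnormD _ _))//.
  apply: (@le_trans _ _ (e + e)); last by lra.
  apply: lerD; first by apply: v1 => n /andP[].
  apply: v3 => n /andP[Pn nM]; rewrite leqNgt; apply/negP => nM'.
  by move: Pn; rewrite PA// /A' (negbTE nM) (negbTE eT).
rewrite leq_eqVlt => /predU1P[->|tT] es ot P N PA MN; last first.
  rewrite !p'p//; apply: pQ => //; [exact: PM'M|exact: leq_trans MN].
(* New column: its block belongs to [A'], where the projection and [v] agree. The four errors are
   the parts of both below [M], the projection from [M'] on, and the remainder of [v]. *)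
rewrite p'T p'p// sT.
have [] := hv (Ordinal sT); rewrite /z ot/=.
rewrite -/(D (p s) (i, j)); set v := D _ _ => v1 v2 v3.
rewrite (basis_projID (fun n => n < M')%N).
rewrite (basis_projID (fun n => n < M)%N _ N).
rewrite (@basis_projID (fun n => n < M)%N xpredT M') in v2.
have h1 : rnorm (Q (fun n => (P n && (n < M')%N) && (n < M)%N) N v) <= e.
  by apply: v1 => n /andP[].
have h2 : rnorm (Q (fun n => P n && ~~ (n < M')%N) N v) <= e.
  by apply: v3 => n /andP[_]; rewrite -leqNgt.
have h3 : rnorm (Q (fun n => xpredT n && (n < M)%N) M' v) <= e.
  by apply: v1 => n.
have h4 : Q (fun n => (P n && (n < M')%N) && ~~ (n < M)%N) N v =
          Q (fun n => xpredT n && ~~ (n < M)%N) M' v.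
  rewrite (@basis_proj_widen _ M')//; last by move=> n /andP[/andP[]].
  rewrite /basis_proj big_nat_cond [RHS]big_nat_cond; apply: eq_bigl => n /=.
  case: (ltnP n M') => nM'; rewrite ?andbF// andbT.
  by case: (ltnP n M) => nM; rewrite ?andbF// PA// /A' ltnNge nM ot.
rewrite h4 {h4}; move: h1 h2 h3 v2.
set a := Q _ _ _; set d := Q _ _ _; set f := Q _ _ _; set h := Q _ _ _.
clearbody a d f h v => h1 h2 h3 h5.
have -> : a + h + d - v = (a + d) - (f + (v - (f + h))).
  rewrite [f + _](_ : _ = v - h); last by rewrite opprD addrCA (addrA f) subrr add0r.
  by rewrite opprB addrA (addrAC a h).
have := rnormB (a + d) (f + (v - (f + h))); have := rnormD a d.
have := rnormD f (v - (f + h)); lra.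
Qed.

End Bound.

End GlidingHump.

(** * The main triangle projection on matrices of differences *)

Definition disjoint_pairs (n : nat) (r : 'I_n -> nat * nat) : Prop :=
  [/\ injective (fun i => (r i).1), injective (fun i => (r i).2) &
      forall i j, (r i).1 <> (r j).2].

Section TriangleProjection.
Context {R : realType} {k : scalar_kind}.
Local Notation K := (Defs.scalar R k).

Lemma disjoint_pairs_increasing (T n : nat) (p : nat -> nat * nat) (f : 'I_n -> nat) :
  (forall s, (s < T)%N -> ((p s).1 < (p s).2)%N) ->
  (forall s t, (s < t)%N -> (t < T)%N -> ((p s).2 < (p t).1)%N) ->
  (forall i, f i < T)%N -> injective f -> disjoint_pairs (p \o f).
Proof.
move=> p1 p2 fT finj.
have lt12 i j : (f i < f j)%N -> [/\ (p (f i)).1 < (p (f i)).2,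
      (p (f i)).2 < (p (f j)).1 & (p (f j)).1 < (p (f j)).2]%N.
  by move=> ij; split; [exact: p1|exact: p2|exact: p1].
split=> [i j /= e|i j /= e|i j /= e].
- have [/lt12[? ? ?]|/lt12[? ? ?]|/finj//] := ltngtP (f i) (f j); lia.
- have [/lt12[? ? ?]|/lt12[? ? ?]|/finj//] := ltngtP (f i) (f j); lia.
- have [/lt12[? ? ?]|/lt12[? ? ?]|/finj ij] := ltngtP (f i) (f j); [lia|lia|].
  by have := p1 _ (fT i); rewrite e ij ltnn.
Qed.

(** The projection of the gliding hump almost fixes the entry i, j if the row precedes the column
    and almost kills it otherwise. [C] depends on the basis only, whereas the pairs may depend on
    the coefficients and on [d]. *)
Lemma triangle_projection (X : completeNormedModType K) (b : nat -> X) :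
  unconditional_basis b ->
  exists2 C : R, 0 < C & forall (Y : nat -> nat -> X) (B : R),
    (forall i j, rnorm (Y i j) <= B) ->
    forall n (a : 'I_n -> 'I_n -> K) (d : R), 0 < d ->
    exists r c : 'I_n -> nat * nat, [/\ disjoint_pairs r, disjoint_pairs c &
      rnorm (\sum_(i < n) \sum_(j < n | (i <= j)%N) a i j *: second_difference Y (r i) (c j)) <=
      C * rnorm (\sum_i \sum_j a i j *: second_difference Y (r i) (c j)) + d].
Proof.
move=> ub; have [C C0 QC] := basis_proj_bounded ub.
exists C => // Y B YB n a d d0.
pose S := \sum_i \sum_j rnorm (a i j).
have S0 : 0 <= S by do 2 (apply: sumr_ge0 => ? _); exact: rnorm_ge0.
(* The errors 4 e |a i j| then add up to at most [d]; the 1 covers the case S = 0. *)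
pose e := d / (4 * (S + 1)).
have e0 : 0 < e by rewrite divr_gt0// mulr_gt0// ltr_wpDl.
have [p [H [M [A [p1 p2 pQ]]]]] := gliding_hump C0 QC YB n.*2 e0.
(* Stage 2 i precedes stage 2 j + 1 exactly when i <= j, so the diagonal belongs to the triangle. *)
pose r (i : 'I_n) := p i.*2; pose c (j : 'I_n) := p j.*2.+1.
have p1' s : (s < n.*2)%N -> ((p s).1 < (p s).2)%N by move=> /p1 /andP[].
have rT (i : 'I_n) : (i.*2 < n.*2)%N by rewrite ltn_double.
have cT (i : 'I_n) : (i.*2.+1 < n.*2)%N by rewrite ltn_Sdouble.
exists r, c; split.
- by apply: (disjoint_pairs_increasing p1' p2 rT) => i j /double_inj/val_inj.
- apply: (disjoint_pairs_increasing p1' p2 cT) => i j [] /double_inj/val_inj//.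
set u := (X in rnorm X <= _); set v := (X in _ * rnorm X).
have -> : u = basis_proj ub A M v - (basis_proj ub A M v - u) by rewrite opprB addrC subrK.
apply: (le_trans (rnormB _ _)); apply: lerD; first exact: QC.
rewrite /v basis_proj_sum /u -sumrB; apply: (le_trans (rnorm_sum _ _ _)).
apply: (@le_trans _ _ (\sum_i \sum_j rnorm (a i j) * (4 * e))); last first.
  rewrite -(eq_bigr _ (fun i _ => mulr_suml _ _ _ _)) -mulr_suml -/S.
  rewrite (_ : S * (4 * e) = d * (S / (S + 1))).
    apply: ler_piMr; first exact: ltW.
    by rewrite ler_pdivrMr ?mul1r ?lerDl ?ler01// ltr_wpDl.
  by rewrite /e; field; rewrite gt_eqF// ltr_wpDl.
apply: ler_sum => i _; rewrite basis_proj_sum [X in _ - X]big_mkcond -sumrB.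
apply: (le_trans (rnorm_sum _ _ _)); apply: ler_sum => j _.
have := pQ i.*2 j.*2.+1 (rT i) (cT j); rewrite odd_double /= odd_double /= => /(_ isT isT A M).
move=> /(_ (fun _ _ => erefl) (leqnn _)); rewrite ltnS leq_double -/(r i) -/(c j) => h.
rewrite basis_projZ; apply: le_trans (ler_wpM2l (rnorm_ge0 (a i j)) h).
by rewrite -rnormZ [in leRHS]scalerBr; case: ifP => _; rewrite ?scaler0.
Qed.

End TriangleProjection.

(** * The dyadic matrix and its triangles *)

Section DyadicMatrix.
Context {R : realType}.

Lemma powR_superadditive (x y t : R) : 0 <= x -> 0 <= y -> 1 <= t ->
  x `^ t + y `^ t <= (x + y) `^ t.
Proof.
move=> x0 y0 t1; have t0 : 0 < t := lt_le_trans ltr01 t1.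
rewrite -(mulr_powRB1 x0 t0) -(mulr_powRB1 y0 t0) -(mulr_powRB1 (addr_ge0 x0 y0) t0).
rewrite mulrDl lerD// ler_wpM2l//;
  by rewrite ge0_ler_powR ?subr_ge0 ?nnegrE ?addr_ge0// (lerDl, lerDr).
Qed.

Lemma powR_midpoint (x y t : R) : 0 <= x -> 0 <= y -> 1 <= t ->
  2 * ((x + y) / 2) `^ t <= x `^ t + y `^ t.
Proof.
move=> x0 y0 t1.
have h0 : 0 <= (2^-1 : R) by rewrite invr_ge0.
have h1 : (2^-1 : R) <= 1 by rewrite invf_le1// ler1n.
have := convex_powR t1 (Itv01 h0 h1) (x := x) (y := y).
rewrite !inE /= !in_itv /= !andbT => /(_ x0 y0).
have E : conv (Itv01 h0 h1) (x : R^o) (y : R^o) = (x + y) / 2 :> R.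
  by rewrite [LHS]convRE /= /unstable.onem; field.
rewrite convRE /= /unstable.onem => h.
have {}h : ((x + y) / 2) `^ t <= 2^-1 * x `^ t + (1 - 2^-1) * y `^ t by rewrite -E.
lra.
Qed.

(** The squared moduli obey the parallelogram law; superadditivity and midpoint convexity of the
    power r / 2 >= 1 do the rest. *)
Lemma clarkson_two_points (k : scalar_kind) (c d : Defs.scalar R k) (r : R) : 2 <= r ->
  2 * (rnorm c `^ r + rnorm d `^ r) <= rnorm (c + d) `^ r + rnorm (c - d) `^ r.
Proof.
move=> r2; have sq (z : Defs.scalar R k) : rnorm z `^ r = (rnorm z ^+ 2) `^ (r / 2).
  by rewrite -powR_mulrn ?rnorm_ge0// -powRrM mulrC divfK.
rewrite !sq; have t1 : 1 <= r / 2 by rewrite ler_pdivlMr// mul1r.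
apply: le_trans (powR_midpoint (sqr_ge0 _) (sqr_ge0 _) t1).
rewrite parallelogram ler_pM2l//.
apply: (le_trans (powR_superadditive (sqr_ge0 _) (sqr_ge0 _) t1)).
by rewrite le_eqVlt; apply/orP; left; apply/eqP; congr (_ `^ _); field.
Qed.

Lemma sum_nat_double (V : nmodType) (F : nat -> V) N :
  \sum_(0 <= i < N + N) F i = \sum_(0 <= i < N) (F i + F (i + N)%N).
Proof.
rewrite (big_cat_nat (leq0n N) (leq_addr N N))/= big_split; congr (_ + _).
by rewrite -{1}[N]add0n big_addn addnK.
Qed.

(* [dyadic_matrix m] is the sum over the dyadic intervals I of length > 1 in
   [0, 2^m) of h_I(i) 1_I(j) / |I|, where h_I is the Haar function of I. *)
Fixpoint dyadic_matrix (m i j : nat) : R :=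
  if m is m'.+1 then
    let N := (2 ^ m')%N in
    (if (i < N)%N then 1 else -1) / (2 ^ m)%:R +
    (if (i < N)%N == (j < N)%N then
       dyadic_matrix m' (if i < N then i else i - N)%N (if j < N then j else j - N)%N
     else 0)
  else 0.

Lemma dyadic_matrix_block (m i j : nat) (e := ((2 ^ m.+1)%:R)^-1 : R) (N := (2 ^ m)%N) :
  (i < N)%N -> (j < N)%N ->
  [/\ dyadic_matrix m.+1 i j = e + dyadic_matrix m i j,
      dyadic_matrix m.+1 i (j + N) = e,
      dyadic_matrix m.+1 (i + N) j = - e &
      dyadic_matrix m.+1 (i + N) (j + N) = - e + dyadic_matrix m i j].
Proof.
move=> iN jN; rewrite /= -/N iN jN ![(_ + N < N)%N]ltnNge ![(N <= _ + N)%N]leq_addl /=.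
by rewrite !addnK mul1r mulN1r !addr0.
Qed.

Section SquareSum.
Context {V : zmodType}.

Definition square_sum N (F : nat -> nat -> V) := \sum_(0 <= i < N) \sum_(0 <= j < N) F i j.

Lemma eq_square_sum N F G : (forall i j, (i < N)%N -> (j < N)%N -> F i j = G i j) ->
  square_sum N F = square_sum N G.
Proof.
by move=> FG; apply: eq_big_nat => i iN; apply: eq_big_nat => j jN; rewrite FG.
Qed.

Lemma square_sumD N F G :
  square_sum N (fun i j => F i j + G i j) = square_sum N F + square_sum N G.
Proof. by rewrite /square_sum -big_split; apply: eq_bigr => i _; rewrite big_split. Qed.

Lemma square_sumN N F : square_sum N (fun i j => - F i j) = - square_sum N F.
Proof. by rewrite /square_sum -sumrN; apply: eq_bigr => i _; rewrite sumrN. Qed.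

Lemma square_sum_double N F : square_sum (N + N) F =
  square_sum N F + square_sum N (fun i j => F i (j + N)%N) +
  (square_sum N (fun i j => F (i + N)%N j) + square_sum N (fun i j => F (i + N)%N (j + N)%N)).
Proof.
rewrite {1}/square_sum sum_nat_double big_split /=.
congr (_ + _); rewrite -square_sumD; by apply: eq_bigr => i _; rewrite sum_nat_double.
Qed.

End SquareSum.

Lemma square_sum_const N (x : R) : square_sum N (fun _ _ => x) = N%:R ^+ 2 * x.
Proof.
by rewrite /square_sum !(sumr_const_nat, subn0) -[LHS]mulr_natl -[x *+ N]mulr_natl mulrA.
Qed.

(** The contributions of e and - e to the two diagonal blocks cancel, and the block above the
    diagonal contributes N^2 e = N / 2. The sums therefore satisfy T_{m+1} = 2 T_m + 2^m / 2. *)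
Lemma dyadic_matrix_upper m :
  square_sum (2 ^ m) (fun i j => if (i <= j)%N then dyadic_matrix m i j else 0) =
  m%:R * (2 ^ m)%:R / 4.
Proof.
elim: m => [|m IH]; first by rewrite /square_sum !big_nat1 /= !mul0r.
have dbl : (2 ^ m.+1 = 2 ^ m + 2 ^ m)%N by rewrite expnS mul2n addnn.
rewrite {1}dbl square_sum_double.
set N := (2 ^ m)%N in IH *; set e := ((2 ^ m.+1)%:R)^-1 : R.
pose t := square_sum N (fun i j => if (i <= j)%N then e else 0).
rewrite [X in X + _ + _](_ : _ = t + m%:R * N%:R / 4); last first.
  rewrite -IH -square_sumD; apply: eq_square_sum => i j iN jN.
  by have [-> _ _ _] := dyadic_matrix_block iN jN; case: ifP => _; rewrite ?addr0.
rewrite [X in _ + X + _](_ : _ = N%:R ^+ 2 * e); last first.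
  rewrite -square_sum_const; apply: eq_square_sum => i j iN jN.
  have [_ -> _ _] := dyadic_matrix_block iN jN.
  by rewrite (leq_trans (ltnW iN))// leq_addl.
rewrite [X in _ + (X + _)](_ : _ = N%:R ^+ 2 * 0); last first.
  rewrite -square_sum_const; apply: eq_square_sum => i j iN jN.
  by rewrite leqNgt (leq_trans jN)// leq_addl.
rewrite [X in _ + (_ + X)](_ : _ = - t + m%:R * N%:R / 4); last first.
  rewrite -IH -square_sumN -square_sumD; apply: eq_square_sum => i j iN jN.
  have [_ _ _ ->] := dyadic_matrix_block iN jN.
  by rewrite leq_add2r; case: ifP => _; rewrite ?oppr0 ?addr0.
rewrite /e dbl natrD -natr1; field.
by rewrite -natrD pnatr_eq0 addn_eq0 expn_eq0.
Qed.

(** The same recursion with the block below the diagonal, whose entries are - e. This triangle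
    serves the transposed matrix. *)
Lemma dyadic_matrix_lower m :
  square_sum (2 ^ m) (fun i j => if (j <= i)%N then dyadic_matrix m i j else 0) =
  - (m%:R * (2 ^ m)%:R / 4).
Proof.
elim: m => [|m IH]; first by rewrite /square_sum !big_nat1 /= !mul0r oppr0.
have dbl : (2 ^ m.+1 = 2 ^ m + 2 ^ m)%N by rewrite expnS mul2n addnn.
rewrite {1}dbl square_sum_double.
set N := (2 ^ m)%N in IH *; set e := ((2 ^ m.+1)%:R)^-1 : R.
pose t := square_sum N (fun i j => if (j <= i)%N then e else 0).
rewrite [X in X + _ + _](_ : _ = t + - (m%:R * N%:R / 4)); last first.
  rewrite -IH -square_sumD; apply: eq_square_sum => i j iN jN.
  by have [-> _ _ _] := dyadic_matrix_block iN jN; case: ifP => _; rewrite ?addr0.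
rewrite [X in _ + X + _](_ : _ = N%:R ^+ 2 * 0); last first.
  rewrite -square_sum_const; apply: eq_square_sum => i j iN jN.
  by rewrite leqNgt (leq_trans iN)// leq_addl.
rewrite [X in _ + (X + _)](_ : _ = N%:R ^+ 2 * - e); last first.
  rewrite -square_sum_const; apply: eq_square_sum => i j iN jN.
  have [_ _ -> _] := dyadic_matrix_block iN jN.
  by rewrite (leq_trans (ltnW jN))// leq_addl.
rewrite [X in _ + (_ + X)](_ : _ = - t + - (m%:R * N%:R / 4)); last first.
  rewrite -IH -square_sumN -square_sumD; apply: eq_square_sum => i j iN jN.
  have [_ _ _ ->] := dyadic_matrix_block iN jN.
  by rewrite leq_add2r; case: ifP => _; rewrite ?oppr0 ?addr0.
rewrite /e dbl natrD -natr1; field.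
by rewrite -natrD pnatr_eq0 addn_eq0 expn_eq0.
Qed.

End DyadicMatrix.

(** * The dyadic matrix as a bilinear form on l_r and its dual *)

Section DyadicForm.
Context {R : realType} {k : scalar_kind}.
Local Notation K := (Defs.scalar R k).
Local Notation r2s := (@scalar_of_real R k).
Implicit Types phi psi : nat -> K.

Definition dyadic_form m phi psi : K :=
  square_sum (2 ^ m) (fun i j => r2s (dyadic_matrix m i j) * (phi i * psi j)).

Lemma square_sum_prod N phi psi : square_sum N (fun i j => phi i * psi j) =
  (\sum_(0 <= i < N) phi i) * (\sum_(0 <= i < N) psi i).
Proof. by rewrite big_distrlr. Qed.

Lemma square_sumZ N (a : K) (F : nat -> nat -> K) :
  square_sum N (fun i j => a * F i j) = a * square_sum N F.
Proof. by rewrite /square_sum mulr_sumr; apply: eq_bigr => i _; rewrite mulr_sumr. Qed.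

(** The last term belongs to the whole interval: its Haar function integrates [phi] to the
    difference of the half sums, its indicator integrates [psi] to the full sum. *)
Lemma dyadic_formS m phi psi (N := (2 ^ m)%N)
    (phi' := fun i => phi (i + N)%N) (psi' := fun i => psi (i + N)%N)
    (S := fun f : nat -> K => \sum_(0 <= i < N) f i) :
  dyadic_form m.+1 phi psi = dyadic_form m phi psi + dyadic_form m phi' psi' +
    r2s ((2 ^ m.+1)%:R^-1) * ((S phi - S phi') * (S psi + S psi')).
Proof.
have dbl : (2 ^ m.+1 = N + N)%N by rewrite expnS mul2n addnn.
set e := ((2 ^ m.+1)%:R)^-1 : R.
rewrite /dyadic_form dbl square_sum_double -/N.
have Sp f g (a : K) : square_sum N (fun i j => a * (f i * g j)) = a * (S f * S g).
  by rewrite square_sumZ square_sum_prod.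
rewrite [X in X + _ + _](_ : _ = r2s e * (S phi * S psi) + dyadic_form m phi psi); last first.
  rewrite -Sp -square_sumD; apply: eq_square_sum => i j iN jN.
  by have [-> _ _ _] := @dyadic_matrix_block R _ _ _ iN jN; rewrite scalar_of_realD mulrDl.
rewrite [X in _ + X + _](_ : _ = r2s e * (S phi * S psi')); last first.
  rewrite -Sp; apply: eq_square_sum => i j iN jN.
  by have [_ -> _ _] := @dyadic_matrix_block R _ _ _ iN jN.
rewrite [X in _ + (X + _)](_ : _ = - r2s e * (S phi' * S psi)); last first.
  rewrite -Sp; apply: eq_square_sum => i j iN jN.
  by have [_ _ -> _] := @dyadic_matrix_block R _ _ _ iN jN; rewrite scalar_of_realN.
rewrite [X in _ + (_ + X)](_ : _ = - r2s e * (S phi' * S psi') + dyadic_form m phi' psi'); last first.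
  rewrite -Sp -square_sumD; apply: eq_square_sum => i j iN jN.
  have [_ _ _ ->] := @dyadic_matrix_block R _ _ _ iN jN.
  by rewrite scalar_of_realD scalar_of_realN mulrDl.
rewrite /dyadic_form -/N; ring.
Qed.

Variables (r r' : R).
Hypotheses (r2 : 2 <= r) (r'0 : 0 < r') (rr' : r^-1 + r'^-1 = 1).

(** The subtracted power of the mean makes the induction close. By Young's inequality the whole
    interval costs its length times the r-th power of half the difference of the means of its
    halves, and by Clarkson's inequality the powers of these two means exceed that of the overall
    mean by at least this amount. The sum over [psi] is paid once per level, whence the factor m. *)
Lemma dyadic_form_young m phi psi (N := (2 ^ m)%N) :
  rnorm (dyadic_form m phi psi) <=
  (\sum_(0 <= i < N) rnorm (phi i) `^ r
     - N%:R * (rnorm (\sum_(0 <= i < N) phi i) / N%:R) `^ r) / r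
  + m%:R * (\sum_(0 <= i < N) rnorm (psi i) `^ r') / r'.
Proof.
have r0 : 0 < r by apply: lt_le_trans r2.
rewrite {}/N; elim: m phi psi => [|m IH] phi psi.
  rewrite /dyadic_form /square_sum !big_nat1 /= scalar_of_real0 mul0r rnorm0.
  by rewrite invr1 mulr1 mul1r subrr !mul0r addr0.
have dbl : (2 ^ m.+1 = 2 ^ m + 2 ^ m)%N by rewrite expnS mul2n addnn.
have N0 : 0 < (2 ^ m)%:R :> R by rewrite ltr0n expn_gt0.
rewrite dyadic_formS; set e := ((2 ^ m.+1)%:R)^-1 : R.
have e0 : 0 < e by rewrite invr_gt0 ltr0n expn_gt0.
have eE : e = ((2 ^ m)%:R + (2 ^ m)%:R)^-1 by rewrite /e dbl natrD.
rewrite dbl !sum_nat_double !big_split /=; set N := (2 ^ m)%N in IH N0 eE *.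
set phi' := fun i => phi (i + N)%N; set psi' := fun i => psi (i + N)%N.
have := IH phi psi; have := IH phi' psi'.
rewrite /phi' /psi'.
set s := \sum_(0 <= i < N) phi i; set s' := \sum_(0 <= i < N) phi (i + N)%N.
set u := \sum_(0 <= i < N) psi i; set u' := \sum_(0 <= i < N) psi (i + N)%N.
set A := \sum_(0 <= i < N) rnorm (phi i) `^ r.
set A' := \sum_(0 <= i < N) rnorm (phi (i + N)%N) `^ r.
set Y := \sum_(0 <= i < N) rnorm (psi i) `^ r'.
set Y' := \sum_(0 <= i < N) rnorm (psi (i + N)%N) `^ r'.
set f1 := dyadic_form _ _ _; set f2 := dyadic_form _ _ _; set f3 := r2s e * _ => h1 h2.
have nr (a : R) : 0 <= a -> rnorm (r2s a) = a by move=> a0; rewrite rnorm_scalar_of_real ger0_norm.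
have h3 : rnorm f3 <= (N%:R + N%:R) * (e * rnorm (s - s')) `^ r / r + (Y + Y') / r'.
  rewrite /f3 !rnormM nr ?(ltW e0)// mulrA; set z := e * rnorm _.
  have z0 : 0 <= z by rewrite mulr_ge0 ?rnorm_ge0 ?ltW.
  have aux (g : nat -> K) : z * rnorm (\sum_(0 <= i < N) g i) <=
      N%:R * z `^ r / r + (\sum_(0 <= i < N) rnorm (g i) `^ r') / r'.
    apply: (le_trans (ler_wpM2l z0 (rnorm_sum _ _ _))).
    rewrite mulr_sumr (_ : N%:R * z `^ r / r = \sum_(0 <= i < N) z `^ r / r); last first.
      by rewrite sumr_const_nat subn0 -[RHS]mulr_natl mulrA.
    rewrite mulr_suml -big_split; apply: ler_sum => i _ /=.
    exact: conjugate_powR (rnorm_ge0 _) r0 r'0 rr'.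
  apply: (le_trans (ler_wpM2l z0 (rnormD _ _))); rewrite mulrDr.
  by apply: (le_trans (lerD (aux psi) (aux (fun i => psi (i + N)%N)))); rewrite -/Y -/Y'; lra.
(* Clarkson's inequality for half the sum and half the difference of the means s / N and s' / N. *)
have h4 : 2 * ((rnorm (s + s') * e) `^ r + (e * rnorm (s - s')) `^ r) <=
    (rnorm s / N%:R) `^ r + (rnorm s' / N%:R) `^ r.
  have := @clarkson_two_points R k (r2s e * (s + s')) (r2s e * (s - s')) r r2.
  rewrite -mulrDr -mulrBr.
  rewrite (_ : s + s' + (s - s') = r2s 2 * s); last first.
    by rewrite (scalar_of_realD 1 1) scalar_of_real1; ring.
  rewrite (_ : s + s' - (s - s') = r2s 2 * s'); last first.
    by rewrite (scalar_of_realD 1 1) scalar_of_real1; ring.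
  rewrite !mulrA -scalar_of_realM (_ : e * 2 = N%:R^-1); last first.
    by rewrite eE; field; rewrite -natrD !pnatr_eq0 addn_eq0 expn_eq0.
  rewrite !rnormM !nr ?invr_ge0 ?(ltW e0) ?(ltW N0)// [e * rnorm (s + s')]mulrC.
  by rewrite ![N%:R^-1 * _]mulrC.
have h5 := rnormD (f1 + f2) f3; have h6 := rnormD f1 f2.
set c0 := (rnorm (s + s') * e) `^ r in h4 *; set z := (e * rnorm (s - s')) `^ r in h3 h4.
set a := (rnorm s / N%:R) `^ r in h2 h4; set a' := (rnorm s' / N%:R) `^ r in h1 h4.
have N_r : 0 <= N%:R / r by rewrite divr_ge0 ?(ltW N0) ?(ltW r0).
have h7 := ler_wpM2l N_r h4.
rewrite (addrC f2) natrD -natr1; lra.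
Qed.

(** Homogeneity: with [phi] scaled by m^(1/r) / s and [psi] by 1 / t, the two terms of the additive
    estimate are at most N m / r and N m / r', of sum N m. *)
Lemma dyadic_form_bound m phi psi (s t : R) (N := (2 ^ m)%N) : (0 < m)%N ->
  0 < s -> 0 < t ->
  \sum_(0 <= i < N) rnorm (phi i) `^ r <= N%:R * s `^ r ->
  \sum_(0 <= i < N) rnorm (psi i) `^ r' <= N%:R * t `^ r' ->
  rnorm (dyadic_form m phi psi) <= m%:R `^ (1 - r^-1) * N%:R * s * t.
Proof.
move=> m0 s0 t0 hphi hpsi.
have r0 : 0 < r by apply: lt_le_trans r2.
have mR : 0 < m%:R :> R by rewrite ltr0n.
pose tau := m%:R `^ r^-1 : R.
have tau0 : 0 < tau by rewrite powR_gt0.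
have taur : tau `^ r = m%:R by rewrite -powRrM mulVf ?gt_eqF// powRr1// ltW.
have N0 : 0 < N%:R :> R by rewrite ltr0n expn_gt0.
pose a : K := r2s (tau / s); pose b : K := r2s t^-1.
have na : rnorm a = tau / s by rewrite rnorm_scalar_of_real gtr0_norm ?divr_gt0.
have nb : rnorm b = t^-1 by rewrite rnorm_scalar_of_real gtr0_norm ?invr_gt0.
have := dyadic_form_young m (fun i => a * phi i) (fun i => b * psi i).
have -> : dyadic_form m (fun i => a * phi i) (fun i => b * psi i) =
    a * b * dyadic_form m phi psi.
  rewrite /dyadic_form -square_sumZ; apply: eq_square_sum => i j _ _; ring.
rewrite !rnormM na nb -/N.
have scaled (f : nat -> K) (c x : R) q : 0 <= c -> 0 < x ->
    \sum_(0 <= i < N) rnorm (f i) `^ q <= N%:R * x `^ q ->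
    forall d : K, rnorm d = c / x ->
    \sum_(0 <= i < N) rnorm (d * f i) `^ q <= N%:R * c `^ q.
  move=> c0 x0 hf d nd; have cx : 0 <= c / x by rewrite divr_ge0// ltW.
  rewrite (eq_bigr (fun i => (c / x) `^ q * rnorm (f i) `^ q)) => [|i _]; last first.
    by rewrite rnormM nd powRM// rnorm_ge0.
  rewrite -mulr_sumr (le_trans (ler_wpM2l (powR_ge0 _ _) hf))//.
  by rewrite mulrCA -powRM ?(ltW x0)// divfK// gt_eqF.
have := scaled _ _ _ _ (ltW tau0) s0 hphi a na; rewrite taur => hX.
have := scaled _ _ _ _ ler01 t0 hpsi b; rewrite div1r powR1 mulr1 => /(_ nb) hY h.
have {}h : tau / s / t * rnorm (dyadic_form m phi psi) <= N%:R * m%:R.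
  apply: (le_trans h).
  rewrite (_ : N%:R * m%:R = N%:R * m%:R / r + N%:R * m%:R / r'); last first.
    by rewrite -mulrDr rr' mulr1.
  rewrite lerD//.
    rewrite ler_wpM2r ?invr_ge0 ?(ltW r0)// (le_trans _ hX)// gerBl.
    by rewrite mulr_ge0 ?powR_ge0// ltW.
  by rewrite ler_wpM2r ?invr_ge0 ?(ltW r'0)// mulrC ler_wpM2r// ltW.
have -> : m%:R `^ (1 - r^-1) = m%:R / tau.
  by rewrite powRB ?(gt_eqF mR) ?implybT// powRr1// ltW.
rewrite -(ler_pM2l (divr_gt0 (divr_gt0 tau0 s0) t0)) (le_trans h)//.
rewrite le_eqVlt; apply/orP; left; apply/eqP; field.
by rewrite !gt_eqF.
Qed.

End DyadicForm.

(** * Matrices with a small form and a large triangle *)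

Section TriangleMatrix.
Context {R : realType} {k : scalar_kind}.
Local Notation K := (Defs.scalar R k).
Local Notation r2s := (@scalar_of_real R k).

Lemma nat_powR_large (M q : R) : 0 < q -> exists m, (0 < m)%N /\ M <= m%:R `^ q.
Proof.
move=> q0; pose x := Num.max M 1.
have x0 : 0 < x by rewrite lt_max ltr01 orbT.
exists (Num.truncn (x `^ q^-1)).+1; split=> //.
apply: (@le_trans _ _ x); first by rewrite le_max lexx.
rewrite [leLHS](_ : x = (x `^ q^-1) `^ q); last first.
  by rewrite -powRrM mulVf ?gt_eqF// powRr1// ltW.
apply: ge0_ler_powR; rewrite ?nnegrE ?powR_ge0 ?ler0n ?(ltW q0)//.
exact/ltW/truncnS_gt.
Qed.

Lemma square_sum_ord (V : zmodType) N (F : nat -> nat -> V) :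
  square_sum N F = \sum_(i < N) \sum_(j < N) F i j.
Proof. by rewrite /square_sum big_mkord; apply: eq_bigr => i _; rewrite big_mkord. Qed.

Let form_le (P Q kappa : R) n (a : 'I_n.+1 -> 'I_n.+1 -> R) :=
  forall (phi psi : 'I_n.+1 -> K) (s t : R), 0 < s -> 0 < t ->
    \sum_i rnorm (phi i) `^ P <= n.+1%:R * s `^ P ->
    \sum_i rnorm (psi i) `^ Q <= n.+1%:R * t `^ Q ->
    rnorm (\sum_i \sum_j r2s (a i j) * (phi i * psi j)) <= kappa * n.+1%:R * s * t.

(** The factor 4 / m brings the triangle sums to modulus 2^m, the size of the matrix, and turns the
    bound m^(1 - 1/P) into 4 m^(-1/P), which is at most [kappa] for large m. *)
Let triangle_matrix_ge2 (P Q kappa : R) : 2 <= P -> 0 < Q -> P^-1 + Q^-1 = 1 ->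
  0 < kappa ->
  exists n (a : 'I_n.+1 -> 'I_n.+1 -> R),
  [/\ `|\sum_(i < n.+1) \sum_(j < n.+1 | (i <= j)%N) a i j| = n.+1%:R,
      `|\sum_(i < n.+1) \sum_(j < n.+1 | (j <= i)%N) a i j| = n.+1%:R &
      form_le P Q kappa a].
Proof.
move=> P2 Q0 PQ k0; have P0 : 0 < P by apply: lt_le_trans P2.
have Pi0 : 0 < P^-1 by rewrite invr_gt0.
have [m [m0 hm]] := nat_powR_large (4 / kappa) Pi0.
have mR : 0 < m%:R :> R by rewrite ltr0n.
have [n NE] : exists n, (2 ^ m = n.+1)%N by exists (2 ^ m).-1; rewrite prednK// expn_gt0.
have sumE (S : rel nat) :
    \sum_(i < n.+1) \sum_(j < n.+1 | S i j) 4 / m%:R * dyadic_matrix m i j =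
    4 / m%:R * square_sum (2 ^ m) (fun i j => if S i j then dyadic_matrix m i j else 0) :> R.
  rewrite NE square_sum_ord mulr_sumr; apply: eq_bigr => i _.
  by rewrite big_mkcond mulr_sumr; apply: eq_bigr => j _; case: ifP; rewrite ?mulr0.
have cancel : 4 / m%:R * (m%:R * (2 ^ m)%:R / 4) = (2 ^ m)%:R :> R.
  by rewrite mulrA [4 / _ * _]mulrA divfK ?gt_eqF// mulrAC divff ?mul1r// pnatr_eq0.
exists n, (fun i j => 4 / m%:R * dyadic_matrix m i j); split.
- by rewrite (sumE leq) dyadic_matrix_upper cancel normr_nat NE.
- by rewrite (sumE (fun i j => j <= i)%N) dyadic_matrix_lower mulrN normrN cancel normr_nat NE.
- move=> phi psi s t s0 t0.
  pose f i := phi (inord i); pose g i := psi (inord i).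
  have sum_inord (h : 'I_n.+1 -> K) q : \sum_i rnorm (h i) `^ q =
      \sum_(0 <= i < 2 ^ m) rnorm (h (inord i)) `^ q.
    by rewrite [in RHS]NE big_mkord; apply: eq_bigr => i _; rewrite inord_val.
  have NR : n.+1%:R = (2 ^ m)%:R :> R by rewrite NE.
  rewrite !sum_inord NR => hf hg.
  have := @dyadic_form_bound R k P Q P2 Q0 PQ m f g s t m0 s0 t0 hf hg.
  rewrite /dyadic_form {1}NE square_sum_ord => h.
  rewrite (_ : \sum_i _ = r2s (4 / m%:R) * \sum_(i < n.+1) \sum_(j < n.+1)
    r2s (dyadic_matrix m i j) * (f i * g j)); last first.
    rewrite mulr_sumr; apply: eq_bigr => i _; rewrite mulr_sumr; apply: eq_bigr => j _.
    by rewrite /f /g !inord_val scalar_of_realM -mulrA.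
  rewrite rnormM rnorm_scalar_of_real ger0_norm ?divr_ge0//.
  apply: (le_trans (ler_wpM2l _ h)); first by rewrite divr_ge0.
  have -> : m%:R `^ (1 - P^-1) = m%:R / m%:R `^ P^-1.
    by rewrite powRB ?(gt_eqF mR) ?implybT// powRr1// ltW.
  have mP : 0 < m%:R `^ P^-1 :> R by rewrite powR_gt0.
  rewrite !mulrA ler_pM2r// ler_pM2r// ler_pM2r ?ltr0n ?expn_gt0//.
  rewrite divfK ?gt_eqF// ler_pdivrMr// mulrC -ler_pdivrMr//.
Qed.

(** If P < 2 then Q >= 2, and the transposed matrix serves, its upper triangle being the lower one
    of the original. [s] and [t] bound the power means of [phi] and [psi]. *)
Lemma triangle_matrix (P Q kappa : R) : 0 < P -> 0 < Q -> P^-1 + Q^-1 = 1 ->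
  0 < kappa ->
  exists n (a : 'I_n.+1 -> 'I_n.+1 -> R),
    `|\sum_(i < n.+1) \sum_(j < n.+1 | (i <= j)%N) a i j| = n.+1%:R /\
    forall (phi psi : 'I_n.+1 -> K) (s t : R), 0 < s -> 0 < t ->
      \sum_i rnorm (phi i) `^ P <= n.+1%:R * s `^ P ->
      \sum_i rnorm (psi i) `^ Q <= n.+1%:R * t `^ Q ->
      rnorm (\sum_i \sum_j r2s (a i j) * (phi i * psi j)) <= kappa * n.+1%:R * s * t.
Proof.
move=> P0 Q0 PQ k0; have [P2|P2] := leP 2 P.
  by have [n [a [h1 _ h2]]] := triangle_matrix_ge2 P2 Q0 PQ k0; exists n, a.
have Q2 : 2 <= Q.
  have : 2^-1 <= P^-1 by rewrite lef_pV2 ?posrE// ltW.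
  move=> h; rewrite -(@lef_pV2 R) ?posrE//; lra.
have [|n [a [_ h1 h2]]] := triangle_matrix_ge2 Q2 P0 _ k0; first by rewrite addrC.
exists n, (fun i j => a j i); split=> [|phi psi s t s0 t0 hp hq].
  rewrite -h1; congr `|_|.
  rewrite (eq_bigr _ (fun i _ => big_mkcond _ _)) exchange_big /=.
  by apply: eq_bigr => i _; rewrite [RHS]big_mkcond.
rewrite exchange_big /= -mulrA [s * t]mulrC mulrA.
have := h2 psi phi t s t0 s0 hq hp; congr (rnorm _ <= _).
by apply: eq_bigr => i _; apply: eq_bigr => j _; rewrite [psi i * _]mulrC.
Qed.
End TriangleMatrix.

(** * Symmetric sequence spaces compared with l_P on finitely many coordinates *)

Section SymmetricSequenceSpaces.
Local Notation coord := Defs.coord.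
Context {R : realType} {k : scalar_kind}.
Local Notation K := (Defs.scalar R k).
Local Notation r2s := (@scalar_of_real R k).

(** For t >= 0 the set of indices with modulus above t lies in the support, so for both sequences it
    has the cardinality of the corresponding set for [v]. *)
Lemma decr_rearr_support (n : nat) (f g : 'I_n -> nat) (v : 'I_n -> K) (x y : nat -> K) :
  injective f -> injective g ->
  (forall i, x (f i) = v i) -> (forall j, (forall i, f i <> j) -> x j = 0) ->
  (forall i, y (g i) = v i) -> (forall j, (forall i, g i <> j) -> y j = 0) ->
  decr_rearr x = decr_rearr y.
Proof.
move=> fi gi xf x0 yg y0; apply/funext => m; rewrite /decr_rearr.
have supp (h : 'I_n -> nat) z t : injective h -> (forall i, z (h i) = v i) ->
    (forall j, (forall i, h i <> j) -> z j = 0) -> 0 <= t ->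
    [set i | t < rnorm (z i)] #= [set i | t < rnorm (v i)].
  move=> hi zh z0 t0; rewrite (_ : mkset _ = h @` [set i | t < rnorm (v i)]).
    by apply: inj_card_eq => a b _ _ /hi.
  apply/seteqP; split=> [j /= tj|_ [i /= ti <-] /=]; last by rewrite zh.
  have [[i hij]|nj] := pselect (exists i, h i = j); first by exists i; rewrite //= -zh hij.
  by move: tj; rewrite z0 ?rnorm0 ?ltNge ?t0// => i hij; apply: nj; exists i.
congr (inf _); apply/seteqP; split=> t [t0 ht]; split=> //.
- rewrite (card_le_eql (supp g y t gi yg y0 t0)).
  by rewrite -(card_le_eql (supp f x t fi xf x0 t0)).
- rewrite (card_le_eql (supp f x t fi xf x0 t0)).
  by rewrite -(card_le_eql (supp g y t gi yg y0 t0)).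
Qed.

Section Space.
Variable E : symmetric_sequence_space R k.

Lemma sss_coordD (x y : E) i : coord (x + y) i = coord x i + coord y i.
Proof. by rewrite -[x]scale1r coord_linear mul1r scale1r. Qed.

Lemma sss_coord0 i : coord (0 : E) i = 0.
Proof. by apply: (addrI (coord (0 : E) i)); rewrite -sss_coordD !addr0. Qed.

Lemma sss_coordZ (a : K) (x : E) i : coord (a *: x) i = a * coord x i.
Proof. by rewrite -[a *: x]addr0 coord_linear sss_coord0 addr0. Qed.

Lemma sss_coordB (x y : E) i : coord (x - y) i = coord x i - coord y i.
Proof. by rewrite sss_coordD -scaleN1r sss_coordZ mulN1r. Qed.

Lemma sss_coord_sum (I : Type) (s : seq I) (P : pred I) (f : I -> E) i :
  coord (\sum_(j <- s | P j) f j) i = \sum_(j <- s | P j) coord (f j) i.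
Proof. by apply: (big_morph (fun x => coord x i)) => [x y|]; [exact: sss_coordD|exact: sss_coord0]. Qed.

Lemma sss_norm_le (x y : E) :
  (forall i, rnorm (coord x i) <= rnorm (coord y i)) -> rnorm x <= rnorm y.
Proof.
move=> xy; have [|z /coord_inj -> ] := @sss_solid _ _ E y (coord x) (@coord_c0 _ _ E x).
  by move=> i; rewrite ler_rnorm.
by rewrite ler_rnorm.
Qed.

Lemma sss_unit_exists i : exists e : E, coord e = (fun j => (j == i)%:R).
Proof.
have [e0 e0E _] := sss_normalised E.
have c0 : in_c0 (fun j => (j == i)%:R : K).
  apply/cvg_rnorm => e e_gt0; exists i.+1 => n ni; by rewrite gtn_eqF// subrr rnorm0.
have [|e eE _] := @sss_symmetric _ _ E e0 _ c0; last by exists e.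
apply: (@decr_rearr_support 1 (fun=> i) (fun=> 0%N) (fun=> 1)).
- by move=> a b _; rewrite !ord1.
- by move=> a b _; rewrite !ord1.
- by move=> _; rewrite eqxx.
- by move=> j /(_ ord0) /eqP; rewrite eq_sym => /negbTE ->.
- by move=> _; rewrite e0E eqxx.
- by move=> j /(_ ord0) /eqP; rewrite e0E eq_sym => /negbTE ->.
Qed.

Definition sss_unit i : E := projT1 (cid (sss_unit_exists i)).

Lemma coord_unit i j : coord (sss_unit i) j = (j == i)%:R.
Proof. by rewrite /sss_unit; case: cid => e /= ->. Qed.

Definition embed n (f : 'I_n -> nat) (v : 'I_n -> K) : E :=
  \sum_i v i *: sss_unit (f i).

Lemma coord_embed n (f : 'I_n -> nat) v i : injective f -> coord (embed f v) (f i) = v i.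
Proof.
move=> fi; rewrite sss_coord_sum (bigD1 i)//= sss_coordZ coord_unit eqxx mulr1 big1 ?addr0//.
by move=> j ji; rewrite sss_coordZ coord_unit (inj_eq fi) eq_sym (negbTE ji) mulr0.
Qed.

Lemma coord_embed0 n (f : 'I_n -> nat) v j : (forall i, f i <> j) -> coord (embed f v) j = 0.
Proof.
move=> fj; rewrite sss_coord_sum big1// => i _.
by have /eqP := fj i; rewrite sss_coordZ coord_unit eq_sym => /negbTE ->; rewrite mulr0.
Qed.

Lemma rnorm_embed n (f g : 'I_n -> nat) v : injective f -> injective g ->
  rnorm (embed f v) = rnorm (embed g v).
Proof.
move=> fi gi; have [|z /coord_inj -> zE] :=
    @sss_symmetric _ _ E (embed g v) _ (@coord_c0 _ _ E (embed f v)).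
  apply: (@decr_rearr_support n f g v) => //.
  - by move=> i; exact: coord_embed.
  - by move=> j; exact: coord_embed0.
  - by move=> i; exact: coord_embed.
  - by move=> j; exact: coord_embed0.
by rewrite /rnorm zE.
Qed.

(** Addition in ['I_n.+1] is modulo n + 1, so the shift is cyclic and only permutes the
    positions. *)
Lemma rnorm_embed_shift n (f : 'I_n.+1 -> nat) v j : injective f ->
  rnorm (embed f (fun i => v (i + j))) = rnorm (embed f v).
Proof.
move=> fi; rewrite (_ : embed f _ = embed (fun i => f (i - j)) v); last first.
  rewrite /embed [RHS](reindex_inj (addIr j)) /=.
  by apply: eq_bigr => i _; rewrite addrK.
by apply: rnorm_embed => // a b /fi /addIr.
Qed.

Lemma rnorm_embed_coord n (f : 'I_n -> nat) (x : E) : injective f ->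
  rnorm (embed f (fun i => coord x (f i))) <= rnorm x.
Proof.
move=> fi; apply: sss_norm_le => j.
have [[i <-]|nj] := pselect (exists i, f i = j); first by rewrite coord_embed.
by rewrite coord_embed0 ?rnorm0 ?rnorm_ge0// => i fij; apply: nj; exists i.
Qed.

(** The fundamental function of the space; by symmetry any n distinct unit vectors give the same
    value. *)
Definition fundamental n : R := rnorm (embed (@nat_of_ord n) (fun=> 1)).

Lemma rnorm_embed_const n (f : 'I_n -> nat) (a : K) : injective f ->
  rnorm (embed f (fun=> a)) = rnorm a * fundamental n.
Proof.
move=> fi; rewrite (rnorm_embed _ fi (@ord_inj n)) /fundamental -rnormZ scaler_sumr.
by congr rnorm; apply: eq_bigr => i _; rewrite scalerA mulr1.
Qed.

Lemma fundamental_gt0 n : 0 < fundamental n.+1.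
Proof.
rewrite rnorm_gt0; apply/eqP => /(congr1 (fun x => coord x 0%N)).
rewrite sss_coord0 (coord_embed _ ord0 (@ord_inj _)) => /eqP; by rewrite oner_eq0.
Qed.

(** The n + 1 cyclic shifts of the selected coordinates add up to a constant vector with their sum
    as entry, and each shift has norm at most that of [x]. *)
Lemma rnorm_sum_coord_le n (f : 'I_n.+1 -> nat) (x : E) : injective f ->
  rnorm (\sum_i coord x (f i)) * fundamental n.+1 <= n.+1%:R * rnorm x.
Proof.
move=> fi; rewrite -(rnorm_embed_const _ fi).
rewrite (_ : embed f _ = \sum_j embed f (fun i => coord x (f (i + j)))); last first.
  rewrite /embed exchange_big; apply: eq_bigr => i _ /=; rewrite -scaler_suml.
  by congr (_ *: _); rewrite [LHS](reindex_inj (addrI i)).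
apply: (le_trans (rnorm_sum _ _ _)).
rewrite (_ : _ * _ = \sum_(j < n.+1) rnorm x); last by rewrite sumr_const card_ord mulr_natl.
apply: ler_sum => j _; rewrite (rnorm_embed_shift (fun i => coord x (f i)))//.
exact: rnorm_embed_coord.
Qed.

(** At each position of [f] the shifts run through all entries of [v], so their combination is
    constant there; elsewhere p > 0 ensures that zeros combine to zero. *)
Lemma lattice_comb_shift p n (f : 'I_n.+1 -> nat) (v : 'I_n.+1 -> K) :
  injective f -> (0 < p)%E ->
  is_lattice_comb p (fun j => embed f (fun i => v (i + j)))
    (embed f (fun=> r2s (lp_comb p (fun j => rnorm (v j))))).
Proof.
move=> fi p0 j; have [[i <-]|nj] := pselect (exists i, f i = j).
  rewrite coord_embed//; congr r2s; case: p p0 => [p||]//= p0.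
  - congr (_ `^ _); rewrite [LHS](reindex_inj (addrI i)).
    by apply: eq_bigr => l _; rewrite coord_embed.
  - rewrite [LHS](reindex_inj (addrI i)).
    by apply: eq_bigr => l _; rewrite coord_embed.
have fj i : f i <> j by move=> fij; apply: nj; exists i.
rewrite coord_embed0//; case: p p0 => [p||]//= p0; rewrite -scalar_of_real0; congr r2s.
- rewrite big1 ?powR0 ?invr_eq0 ?gt_eqF// => l _.
  by rewrite coord_embed0// rnorm0 powR0// gt_eqF.
- by apply/esym; elim/big_ind: _ => // [a b -> ->|l _]; rewrite ?maxxx// coord_embed0// rnorm0.
Qed.

Lemma powR_le1D (a p P : R) : 0 <= a -> 0 <= p <= P -> a `^ p <= 1 + a `^ P.
Proof.
move=> a0 /andP[p0 pP]; have [a1|a1] := leP a 1.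
  apply: (@le_trans _ _ 1); last by rewrite lerDl powR_ge0.
  by have := ge0_ler_powR p0 _ _ a1; rewrite powR1 !nnegrE; apply.
apply: (@le_trans _ _ (a `^ P)); first by rewrite ler_powR// ltW.
by rewrite lerDr ler01.
Qed.

(** Comparison of power means. The pointwise bound a^p <= 1 + a^P, applied to v_i / t, gives it with
    the factor 2. *)
Lemma sum_powR_le n (v : 'I_n -> R) (p P t : R) : (forall i, 0 <= v i) ->
  0 <= p <= P -> 0 < t ->
  \sum_i v i `^ P <= n%:R * t `^ P -> \sum_i v i `^ p <= 2 * n%:R * t `^ p.
Proof.
move=> v0 pP t0 h.
have tp : 0 < t `^ p by rewrite powR_gt0.
have tP : 0 < t `^ P by rewrite powR_gt0.
have vE i q : v i `^ q = t `^ q * (v i / t) `^ q.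
  by rewrite -powRM ?divr_ge0 ?(ltW t0)// mulrC divfK// gt_eqF.
apply: (@le_trans _ _ (\sum_i (t `^ p + t `^ p * (v i / t) `^ P))).
  apply: ler_sum => i _; rewrite vE -[X in X + _]mulr1 -mulrDr ler_pM2l//.
  by rewrite powR_le1D// divr_ge0// ltW.
rewrite big_split -mulr_sumr /= sumr_const card_ord -[_ *+ n]mulr_natl.
move: h; rewrite (eq_bigr _ (fun i _ => vE i P)) -mulr_sumr mulrC ler_pM2r// => h.
have := ler_wpM2l (ltW tp) h; lra.
Qed.

(** Concavity for the n + 1 cyclic shifts, all of the same norm, bounds that norm by the norm of the
    constant vector whose entry is the p-th power mean; passing to the mean of order [P] costs
    2^(1/p). *)
Lemma q_concave_embed (p P : R) : 1 <= p -> p <= P -> q_concave E p%:E ->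
  exists2 C : R, 0 < C & forall n (f : 'I_n.+1 -> nat) v t, injective f -> 0 < t ->
    \sum_i rnorm (v i) `^ P <= n.+1%:R * t `^ P ->
    rnorm (embed f v) <= C * fundamental n.+1 * t.
Proof.
move=> p1 pP [C C0 hC]; have p0 : 0 < p := lt_le_trans ltr01 p1.
have p0i : 0 <= p^-1 by rewrite invr_ge0 ltW.
exists (C * 2 `^ p^-1) => [|n f v t fi t0 hv]; first by rewrite mulr_gt0// powR_gt0.
have := hC _ _ _ (lattice_comb_shift v fi (p0 : (0 < p%:E)%E)).
rewrite rnorm_embed_const//= rnorm_scalar_of_real ger0_norm ?powR_ge0//.
rewrite (eq_bigr (fun=> rnorm (embed f v) `^ p)) => [|j _]; last by rewrite rnorm_embed_shift.
rewrite sumr_const card_ord -[_ *+ _]mulr_natl powRM ?powR_ge0 ?ler0n//.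
rewrite -powRrM divff ?gt_eqF// powRr1 ?rnorm_ge0// => h.
have N0 : 0 < n.+1%:R `^ p^-1 :> R by rewrite powR_gt0.
have key : (\sum_i rnorm (v i) `^ p) `^ p^-1 <= 2 `^ p^-1 * n.+1%:R `^ p^-1 * t.
  rewrite (_ : _ * t = (2 * n.+1%:R * t `^ p) `^ p^-1); last first.
    rewrite !powRM ?mulr_ge0 ?powR_ge0// -powRrM divff ?gt_eqF//.
    by rewrite powRr1 ?(ltW t0).
  apply: ge0_ler_powR => //; rewrite ?nnegrE ?mulr_ge0 ?powR_ge0//.
    by apply: sumr_ge0 => i _; exact: powR_ge0.
  by apply: (@sum_powR_le _ _ p P) => // [i|]; [exact: rnorm_ge0|rewrite (ltW p0)].
have F0 := fundamental_gt0 n.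
rewrite -(ler_pM2l N0) (le_trans h)//.
rewrite [leRHS](_ : _ = C * ((2 `^ p^-1 * n.+1%:R `^ p^-1 * t) * fundamental n.+1)); last by ring.
by rewrite ler_pM2l// ler_pM2r.
Qed.

(** Convexity for the cyclic shifts gives the reverse estimate: the norm of [x] controls the p-th
    power mean of its coordinates, hence the one of order [P]. The factor 2 of that comparison is
    absorbed through 2 <= 2^P. *)
Lemma p_convex_coord (p : \bar R) (P : R) : (1 <= p)%E -> 1 <= P -> (P%:E <= p)%E ->
  p_convex E p ->
  exists2 C : R, 0 < C & forall n (f : 'I_n.+1 -> nat) (x : E), injective f -> x != 0 ->
    \sum_i rnorm (coord x (f i)) `^ P <=
      n.+1%:R * (C * rnorm x / fundamental n.+1) `^ P.
Proof.
move=> p1 P1 Pp [C C0 hC]; have P0 : 0 < P := lt_le_trans ltr01 P1.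
have cE n (f : 'I_n.+1 -> nat) (x : E) : injective f ->
    lp_comb p (fun i => rnorm (coord x (f i))) * fundamental n.+1 <=
    C * lp_comb p (fun _ : 'I_n.+1 => rnorm x).
  move=> fi; have := hC _ _ _ (lattice_comb_shift (fun i => coord x (f i)) fi (lt_le_trans lte01 p1)).
  have l0 : 0 <= lp_comb p (fun i => rnorm (coord x (f i))).
    case: p {Pp hC} p1 => [p||]//= p1; first exact: powR_ge0.
    by elim/big_ind: _ => // [a b a0 b0|i _]; [rewrite le_max a0|exact: rnorm_ge0].
  rewrite rnorm_embed_const//= rnorm_scalar_of_real ger0_norm// => h.
  apply: (le_trans h); rewrite ler_pM2l//.
  have le1 j : rnorm (embed f (fun i => coord x (f (i + j)))) <= rnorm x.
    by rewrite (rnorm_embed_shift (fun i => coord x (f i)))// rnorm_embed_coord.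
  case: p {Pp hC l0 h} p1 => [p||]//= p1.
    have p0 : 0 < p := lt_le_trans ltr01 p1.
    apply: ge0_ler_powR; rewrite ?invr_ge0 ?(ltW p0) ?nnegrE//.
    - by apply: sumr_ge0 => i _; exact: powR_ge0.
    - by apply: sumr_ge0 => i _; exact: powR_ge0.
    by apply: ler_sum => i _; apply: ge0_ler_powR; rewrite ?(ltW p0) ?nnegrE ?rnorm_ge0.
  by apply: le_bigmax2 => i _; exact: le1.
exists (2 * C) => [|n f x fi x0]; first exact: mulr_gt0.
have F0 := fundamental_gt0 n.
have nx : 0 < rnorm x by rewrite rnorm_gt0.
pose t := C * rnorm x / fundamental n.+1.
have t0 : 0 < t by rewrite divr_gt0// mulr_gt0.
have tE : 2 * C * rnorm x / fundamental n.+1 = 2 * t by rewrite /t; ring.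
have {cE} := cE n f x fi; rewrite {}tE.
case: p Pp {hC} p1 => [p||]//= Pp p1.
  have p0 : 0 < p := lt_le_trans ltr01 p1.
  have pp : p^-1 * p = 1 by rewrite mulVf// gt_eqF.
  rewrite sumr_const card_ord -[_ *+ _]mulr_natl powRM ?powR_ge0 ?ler0n//.
  rewrite -powRrM divff ?gt_eqF// powRr1 ?(ltW nx)// => h.
  have {}h : \sum_i rnorm (coord x (f i)) `^ p <= n.+1%:R * t `^ p.
    set S := \sum_i _ in h *.
    have S0 : 0 <= S by apply: sumr_ge0 => i _; exact: powR_ge0.
    have : (S `^ p^-1) `^ p <= (n.+1%:R `^ p^-1 * t) `^ p.
      apply: ge0_ler_powR; rewrite ?nnegrE ?(mulr_ge0 (powR_ge0 _ _) (ltW t0))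
        ?powR_ge0 ?(ltW p0)//.
      by rewrite /t mulrA ler_pdivlMr// mulrCA.
    by rewrite powRM ?powR_ge0 ?(ltW t0)// -!powRrM pp !powRr1.
  have pP : 0 <= P <= p by rewrite (ltW P0).
  apply: (le_trans (sum_powR_le (fun i => rnorm_ge0 _) pP t0 h)).
  rewrite powRM ?(ltW t0)// mulrA ler_pM2r ?powR_gt0// [leRHS]mulrC ler_pM2r//.
  by rewrite -[leLHS]powRr1// ler_powR// ler1n.
move=> h; have le1 i : rnorm (coord x (f i)) <= 2 * t.
  apply: (@le_trans _ _ t); last by rewrite ler_peMl ?(ltW t0)// ler1n.
  rewrite /t ler_pdivlMr//; apply: le_trans (le_trans _ h) _.
    by rewrite ler_pM2r//; exact: le_bigmax.
  rewrite ler_pM2l//; apply/bigmax_leP; split; [exact: rnorm_ge0|by []].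
rewrite mulr_natl -[n.+1 in leRHS]card_ord -sumr_const; apply: ler_sum => i _.
apply: ge0_ler_powR; rewrite ?(ltW P0) ?nnegrE ?rnorm_ge0//.
by rewrite mulr_ge0 ?(ltW t0).
Qed.

End Space.
End SymmetricSequenceSpaces.

(** * Bounds for the injective and projective norms *)

Section TensorNorms.
Local Notation coord := Defs.coord.
Context {R : realType} {k : scalar_kind}.
Local Notation K := (Defs.scalar R k).
Local Notation r2s := (@scalar_of_real R k).
Context {E F : normedModType K} (W : algebraic_tensor_product E F).

Lemma tensor_lift (f : E -> F -> K) :
  (forall y, linear_for *%R (f^~ y)) -> (forall x, linear_for *%R (f x)) ->
  exists g : {linear W -> K^o}, forall x y, g (tensor W x y) = f x y.
Proof.
move=> fl fr.
have bf : bilinear_for *:%R *:%R (f : E -> F -> K^o) by split.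
pose f' : {bilinear E -> F -> K^o} :=
  HB.pack (f : E -> F -> K^o) (bilinear_isBilinear.Build _ _ _ _ _ _ _ bf).
by have [g [gP _]] := tensor_universal W f'; exists g.
Qed.

Lemma functional_tensor_lift (phi : {scalar E}) (psi : {scalar F}) :
  exists g : {linear W -> K^o}, forall x y, g (tensor W x y) = phi x * psi y.
Proof.
apply: (tensor_lift (f := fun x y => phi x * psi y)) => [y a u v|x a u v].
  by rewrite linearP /= mulrDl mulrA.
by rewrite linearP /= mulrDr mulrCA.
Qed.

(** Every tensor has this form. Carrying it as a predicate spares its derivation from the universal
    property and ensures that the sets behind the two norms are nonempty. *)
Definition finite_rank (w : W) : Prop :=
  exists (n : nat) (x : 'I_n -> E) (y : 'I_n -> F), w = \sum_(j < n) tensor W (x j) (y j).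

Lemma finite_rank_tensor x y : finite_rank (tensor W x y).
Proof. by exists 1%N, (fun=> x), (fun=> y); rewrite big_ord1. Qed.

Lemma finite_rankZ a x y : finite_rank (a *: tensor W x y).
Proof. by rewrite -linearZl_LR; exact: finite_rank_tensor. Qed.

Lemma finite_rank_sum (I : Type) (s : seq I) (P : pred I) (f : I -> W) :
  (forall i, P i -> finite_rank (f i)) -> finite_rank (\sum_(i <- s | P i) f i).
Proof.
move=> fP; apply: (big_ind finite_rank) => //.
  exists 0%N, (fun=> 0), (fun=> 0); by rewrite big_ord0.
move=> _ _ [n [x [y ->]]] [n' [x' [y' ->]]].
exists (n + n')%N, (fun j => match fintype.split j with inl i => x i | inr i => x' i end),
  (fun j => match fintype.split j with inl i => y i | inr i => y' i end).
rewrite big_split_ord /=; congr (_ + _); apply: eq_bigr => i _.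
  by rewrite (unsplitK (inl i)).
by rewrite (unsplitK (inr i)).
Qed.

Let lift_sum (phi : {scalar E}) (psi : {scalar F}) (g : {linear W -> K^o}) n
    (x : 'I_n -> E) (y : 'I_n -> F) :
  (forall x y, g (tensor W x y) = phi x * psi y) ->
  \sum_(j < n) phi (x j) * psi (y j) = g (\sum_(j < n) tensor W (x j) (y j)).
Proof. by move=> gE; rewrite linear_sum; apply: eq_bigr => j _; rewrite gE. Qed.

Lemma injective_norm_le (w : W) (c : R) : finite_rank w ->
  (forall (phi : {scalar E}) (psi : {scalar F}) (g : {linear W -> K^o}),
     in_dual_ball phi -> in_dual_ball psi ->
     (forall x y, g (tensor W x y) = phi x * psi y) -> rnorm (g w : K) <= c) ->
  injective_norm w <= c.
Proof.
move=> [n [x [y wE]]] h; apply: ge_sup.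
  (* The zero functionals show that the supremum is over a nonempty set. *)
  pose z1 : {scalar E} := \0; pose z2 : {scalar F} := \0.
  exists (rnorm (\sum_(j < n) z1 (x j) * z2 (y j))).
  by exists n, x, y, z1, z2; split=> // z; rewrite /in_dual_ball /= normr0.
move=> _ [m [x' [y' [phi [psi [wE' bphi bpsi ->]]]]]].
have [g gE] := functional_tensor_lift phi psi.
by rewrite (lift_sum _ _ gE) -wE'; exact: h.
Qed.

(** The values depend on the tensor only, through the lifted form, so one representation bounds all
    of them by the sum of the products of its norms and the supremum is attained as a real number
    bound. *)
Lemma injective_norm_ge (w : W) (phi : {scalar E}) (psi : {scalar F})
    (g : {linear W -> K^o}) : finite_rank w ->
  in_dual_ball phi -> in_dual_ball psi ->
  (forall x y, g (tensor W x y) = phi x * psi y) ->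
  rnorm (g w : K) <= injective_norm w.
Proof.
move=> [n [x [y wE]]] bphi bpsi gE; apply: ub_le_sup; last first.
  by exists n, x, y, phi, psi; split=> //; rewrite (lift_sum _ _ gE) -wE.
exists (\sum_(j < n) rnorm (x j) * rnorm (y j)).
move=> _ [m [x' [y' [phi' [psi' [wE' b1 b2 ->]]]]]].
have [g' gE'] := functional_tensor_lift phi' psi'.
rewrite (lift_sum _ _ gE') -wE' wE -(lift_sum _ _ gE').
apply: (le_trans (rnorm_sum _ _ _)); apply: ler_sum => j _.
rewrite rnormM ler_pM ?rnorm_ge0//.
  by have := b1 (x j); rewrite ler_rnorm.
by have := b2 (y j); rewrite ler_rnorm.
Qed.

Lemma injective_norm_tensor x y : injective_norm (tensor W x y) <= rnorm x * rnorm y.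
Proof.
apply: injective_norm_le => [|phi psi g b1 b2 ->]; first exact: finite_rank_tensor.
rewrite rnormM ler_pM ?rnorm_ge0//.
  by have := b1 x; rewrite ler_rnorm.
by have := b2 y; rewrite ler_rnorm.
Qed.

Lemma projective_norm_tensor x y : projective_norm (tensor W x y) <= rnorm x * rnorm y.
Proof.
apply: ge_inf.
  exists 0 => _ [n [x' [y' [_ ->]]]]; apply: sumr_ge0 => j _.
  by rewrite mulr_ge0 ?rnorm_ge0.
by exists 1%N, (fun=> x), (fun=> y); rewrite !big_ord1.
Qed.

(** Bounded bilinear forms bound the projective norm from below; a representation of [w] keeps the
    infimum from being that of the empty set. *)
Lemma projective_norm_ge (w : W) (M : R) (g : {linear W -> K^o}) : finite_rank w ->
  0 < M ->
  (forall x y, rnorm (g (tensor W x y) : K) <= M * (rnorm x * rnorm y)) ->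
  rnorm (g w : K) <= M * projective_norm w.
Proof.
move=> [n [x [y wE]]] M0 gM; rewrite -ler_pdivrMl//.
apply: lb_le_inf; first by exists (\sum_(j < n) rnorm (x j) * rnorm (y j)), n, x, y.
move=> _ [m [x' [y' [-> ->]]]]; rewrite ler_pdivrMl// mulr_sumr linear_sum.
by apply: (le_trans (rnorm_sum _ _ _)); apply: ler_sum => j _.
Qed.

End TensorNorms.

(** * Transfer to tensor products, duality, choice of exponents *)

Section Embeddings.
Local Notation coord := Defs.coord.
Context {R : realType} {k : scalar_kind}.
Local Notation K := (Defs.scalar R k).
Local Notation r2s := (@scalar_of_real R k).

Definition unit_difference (E : symmetric_sequence_space R k) (p : nat * nat) : E :=
  sss_unit E p.1 - sss_unit E p.2.

Local Notation d := unit_difference.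

(** The inequality for elementary tensors bounds the images of all e_i (x) f_j uniformly, since all
    unit vectors of a space have the same norm; passing through the embedding costs the ratio of its
    two constants. *)
Lemma triangle_tensor (E F : symmetric_sequence_space R k)
    (W : algebraic_tensor_product E F) (N : W -> R) (T : completion N) :
  (forall x y, N (tensor W x y) <= rnorm x * rnorm y) ->
  embeds_in_unconditional T ->
  exists2 C : R, 0 < C & forall n (a : 'I_n -> 'I_n -> K) (e : R), 0 < e ->
    exists r c : 'I_n -> nat * nat, [/\ disjoint_pairs r, disjoint_pairs c &
      N (\sum_(i < n) \sum_(j < n | (i <= j)%N) a i j *: tensor W (d E (r i)) (d F (c j)))
      <= C * N (\sum_i \sum_j a i j *: tensor W (d E (r i)) (d F (c j))) + e].
Proof.
move=> NE [X [b [ub [J [c' [C' [c0 C0 JC]]]]]]].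
have [C1 C10 tri] := triangle_projection ub.
pose cR : R := scalar_re c'; pose CR : R := scalar_re C'.
have cE : c' = r2s cR by apply: ger0_scalar; exact: ltW.
have CE : C' = r2s CR by apply: ger0_scalar; exact: ltW.
have cR0 : 0 < cR by rewrite -(@ltr_scalar_of_real R k) scalar_of_real0 -cE.
have CR0 : 0 < CR by rewrite -(@ltr_scalar_of_real R k) scalar_of_real0 -CE.
pose I w : X := J (completion_map T w).
have IN w : cR * N w <= rnorm (I w) /\ rnorm (I w) <= CR * N w.
  have := JC (completion_map T w); rewrite cE CE !normr_rnorm -!scalar_of_realM.
  by rewrite !ler_scalar_of_real completion_isometry => /andP[].
have Isum n (P : rel 'I_n) (a : 'I_n -> 'I_n -> K) (f : 'I_n -> 'I_n -> W) :
    I (\sum_i \sum_(j | P i j) a i j *: f i j) = \sum_i \sum_(j | P i j) a i j *: I (f i j).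
  rewrite /I !linear_sum; apply: eq_bigr => i _; rewrite !linear_sum.
  by apply: eq_bigr => j _; rewrite !linearZ.
pose Y i j := I (tensor W (sss_unit E i) (sss_unit F j)).
have YD p q : second_difference Y p q = I (tensor W (d E p) (d F q)).
  by rewrite /second_difference /Y /d linearBr !linearBl /I !linearB.
have nu (G : symmetric_sequence_space R k) i : rnorm (sss_unit G i) = fundamental G 1.
  rewrite -[RHS]mul1r -(@rnorm1 R k) -(rnorm_embed_const G (f := fun _ : 'I_1 => i)).
    by rewrite /embed big_ord1 scale1r.
  by move=> x y _; rewrite !ord1.
have YB i j : rnorm (Y i j) <= CR * (fundamental E 1 * fundamental F 1).
  apply: (le_trans (IN _).2); rewrite ler_pM2l//.
  by apply: (le_trans (NE _ _)); rewrite !nu.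
exists (C1 * CR / cR) => [|n a e e0]; first by rewrite divr_gt0// mulr_gt0.
have [r [c [hr hc h]]] := tri Y _ YB n a (cR * e) (mulr_gt0 cR0 e0).
exists r, c; split=> //.
have YE (P : rel 'I_n) :
    \sum_i \sum_(j | P i j) a i j *: second_difference Y (r i) (c j) =
    I (\sum_i \sum_(j | P i j) a i j *: tensor W (d E (r i)) (d F (c j))).
  by rewrite Isum; apply: eq_bigr => i _; apply: eq_bigr => j _; rewrite YD.
move: h; rewrite (YE (fun i j => (i <= j)%N)) (YE (fun _ _ => true)).
set u := \sum_(i < n) \sum_(j < n | (i <= j)%N) _; set v := \sum_i \sum_j _ => h.
rewrite -(ler_pM2l cR0) mulrDr (le_trans (IN _).1)// (le_trans h)// lerD2r.
rewrite (_ : cR * _ = C1 * (CR * N v)); last by field; rewrite gt_eqF.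
by rewrite ler_pM2l//; exact: (IN v).2.
Qed.

(** The duality of l_P and l_Q, with both norms written as power means. *)
Lemma dual_sum_powR n (P Q D : R) (phi : 'I_n.+1 -> K) : 0 < P -> 0 < Q ->
  P^-1 + Q^-1 = 1 -> 0 < D ->
  (forall (w : 'I_n.+1 -> K) t, 0 < t -> \sum_i rnorm (w i) `^ P <= n.+1%:R * t `^ P ->
     rnorm (\sum_i w i * phi i) <= D * t) ->
  \sum_i rnorm (phi i) `^ Q <= n.+1%:R * (D / n.+1%:R) `^ Q.
Proof.
move=> P0 Q0 PQ D0 h; set S := \sum_i _.
have S0 : 0 <= S by apply: sumr_ge0 => i _; exact: powR_ge0.
have N0 : 0 < n.+1%:R :> R by [].
have [->|Sn0] := eqVneq S 0; first by rewrite mulr_ge0// powR_ge0.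
have {Sn0}S0 : 0 < S by rewrite lt_def Sn0.
pose x := S / n.+1%:R; have x0 : 0 < x by rewrite divr_gt0.
have SE : S = n.+1%:R * x by rewrite mulrC divfK// gt_eqF.
(* The extremal vector of Hoelder's inequality: w_i phi_i and |w_i|^P both equal |phi_i|^Q. Division
   by zero gives 0, which is the right entry where phi_i = 0. *)
pose w i := r2s (rnorm (phi i) `^ Q) / phi i.
have wphi i : w i * phi i = r2s (rnorm (phi i) `^ Q).
  have [f0|f0] := eqVneq (phi i) 0; last by rewrite /w divfK.
  by rewrite f0 mulr0 rnorm0 powR0 ?scalar_of_real0// gt_eqF.
have wP i : rnorm (w i) `^ P = rnorm (phi i) `^ Q.
  rewrite /w rnormM rnormV rnorm_scalar_of_real ger0_norm ?powR_ge0//.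
  have [->|f0] := eqVneq (phi i) 0.
    by rewrite rnorm0 invr0 mulr0 !powR0// gt_eqF.
  have f1 : 0 < rnorm (phi i) by rewrite rnorm_gt0.
  rewrite -(powR_inv1 (ltW f1)) -powRD ?(gt_eqF f1) ?implybT// -powRrM.
  congr (_ `^ _); have -> : Q = P / (P - 1).
    have P1 : P - 1 != 0.
      apply/eqP => P1; have PE : P = 1 by lra.
      move: PQ; rewrite PE invr1 => /eqP; rewrite -subr_eq0 addrAC subrr add0r invr_eq0.
      by rewrite gt_eqF.
    have : Q^-1 = 1 - P^-1 by rewrite -PQ addrC addKr.
    move=> /(congr1 GRing.inv); rewrite invrK => ->; field.
    by rewrite P1 gt_eqF.
  field; apply/eqP => P1; have PE : P = 1 by lra.
  move: PQ; rewrite PE invr1 => /eqP; rewrite -subr_eq0 addrAC subrr add0r invr_eq0.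
  by rewrite gt_eqF.
have xP : (x `^ P^-1) `^ P = x by rewrite -powRrM mulVf ?gt_eqF// powRr1// ltW.
have := h w (x `^ P^-1) (powR_gt0 _ x0).
rewrite xP (eq_bigr _ (fun i _ => wP i)) -/S {1}SE lexx => /(_ isT).
rewrite (eq_bigr _ (fun i _ => wphi i)) -scalar_of_real_sum rnorm_scalar_of_real -/S.
rewrite gtr0_norm// => hS; rewrite SE ler_pM2l//.
have xQ : (x `^ Q^-1) `^ Q = x by rewrite -powRrM mulVf ?gt_eqF// powRr1// ltW.
rewrite -xQ; apply: ge0_ler_powR; rewrite ?nnegrE ?powR_ge0 ?(ltW Q0)//.
  by rewrite divr_ge0// ltW.
have y0 : 0 < x `^ P^-1 by rewrite powR_gt0.
rewrite ler_pdivlMr// -(ler_pM2l y0) mulrA -powRD ?PQ ?(gt_eqF x0) ?implybT//.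
by rewrite powRr1 ?(ltW x0)// mulrC -SE mulrC.
Qed.

Lemma hoelder_conjugate_EFin (x : R) : 1 < x -> hoelder_conjugate x%:E = (x / (x - 1))%:E.
Proof.
move=> x1; rewrite /hoelder_conjugate/= gt_eqF ?(lt_trans lte01)//.
by rewrite -EFinD inver subr_eq0 gt_eqF// -EFinM.
Qed.

Lemma conjugate_inverse_sum (x : R) : 1 < x ->
  [/\ 0 < x / (x - 1), 1 <= x / (x - 1) & x^-1 + (x / (x - 1))^-1 = 1].
Proof.
move=> x1; have x0 : 0 < x by rewrite (lt_trans ltr01).
have x10 : 0 < x - 1 by rewrite subr_gt0.
split; first by rewrite divr_gt0.
  by rewrite ler_pdivlMr// mul1r gerBl ler01.
by field; rewrite !gt_eqF.
Qed.

(** If p > 1, then p and its conjugate serve. If p = 1, the conjugate is infinite, and Q = max(q, 2)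
    with its own conjugate is taken instead. *)
Lemma conjugate_above (p q : \bar R) : (1 <= p)%E -> (1 <= q)%E ->
  p <> +oo%E -> q <> +oo%E -> (q <= hoelder_conjugate p)%E ->
  exists x y P Q : R, [/\ p = x%:E, q = y%:E, 1 <= x <= P, 1 <= y <= Q &
    [/\ 0 < P, 0 < Q & P^-1 + Q^-1 = 1]].
Proof.
case: p => [x||]// x1; case: q => [y||]// y1 _ _.
rewrite !lee_fin in x1 y1; move: (x1); rewrite le_eqVlt => /predU1P[<-|x2].
  move=> _; pose Q := Num.max y 2.
  have Q1 : 1 < Q by rewrite lt_max ltr1n orbT.
  have [h1 h2 h3] := conjugate_inverse_sum Q1.
  exists 1, y, (Q / (Q - 1)), Q; split=> //; rewrite ?lexx ?y1 ?le_max ?lexx//.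
  by split=> //; [rewrite (lt_trans ltr01)|rewrite addrC].
rewrite hoelder_conjugate_EFin// lee_fin => yx.
have [h1 h2 h3] := conjugate_inverse_sum x2.
exists x, y, x, (x / (x - 1)); split=> //; rewrite ?x1 ?y1 ?lexx//.
by split=> //; rewrite (lt_trans ltr01).
Qed.

(** If p is infinite, any real Q with 1 < Q <= q serves, together with its conjugate. *)
Lemma conjugate_below (p q : \bar R) : (1 <= p)%E -> (1 <= q)%E ->
  p <> 1%E -> q <> 1%E -> (hoelder_conjugate p <= q)%E ->
  exists P Q : R, [/\ (P%:E <= p)%E, (Q%:E <= q)%E, 1 <= P, 1 <= Q & P^-1 + Q^-1 = 1].
Proof.
move=> + q1 p1 q2; rewrite le_eqVlt => /predU1P[/esym //|].
case: p p1 => [x||]// _.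
  rewrite lte_fin => x1; rewrite hoelder_conjugate_EFin// => xq.
  have [h1 h2 h3] := conjugate_inverse_sum x1.
  by exists x, (x / (x - 1)); split=> //; exact: ltW.
move=> _ _; have {q2 q1} : (1 < q)%E by rewrite lt_def q1 andbT; apply/eqP.
move=> q1; have [Q Q1 Qq] : exists2 Q : R, 1 < Q & (Q%:E <= q)%E.
  by case: q q1 => [y||]//; [exists y|exists 2; rewrite ?ltr1n ?leey].
have [h1 h2 h3] := conjugate_inverse_sum Q1.
by exists (Q / (Q - 1)), Q; split; rewrite ?leey// ?(ltW Q1)// addrC.
Qed.

End Embeddings.

(** * The two contradictions *)

Section Contradictions.
Local Notation coord := Defs.coord.
Context {R : realType} {k : scalar_kind}.
Local Notation K := (Defs.scalar R k).
Local Notation r2s := (@scalar_of_real R k).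
Local Notation d := unit_difference.

Section OneSpace.
Variable E : symmetric_sequence_space R k.

Lemma coord_unit_difference n (r : 'I_n -> nat * nat) i j : disjoint_pairs r ->
  coord (d E (r i)) (r j).1 = (i == j)%:R.
Proof.
move=> [r1 _ r12]; rewrite sss_coordB !coord_unit (inj_eq (f := fun i => (r i).1) r1).
by rewrite (negbTE (introN eqP (r12 j i))) subr0 eq_sym.
Qed.

Lemma sum_unit_difference n (r : 'I_n -> nat * nat) v :
  \sum_i v i *: d E (r i) =
  embed E (fun i => (r i).1) v - embed E (fun i => (r i).2) v.
Proof. by rewrite -sumrB; apply: eq_bigr => i _; rewrite scalerBr. Qed.

Lemma sum_unit_difference_le n (r : 'I_n -> nat * nat) v (B : R) : disjoint_pairs r ->
  (forall f, injective f -> rnorm (embed E f v) <= B) ->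
  rnorm (\sum_i v i *: d E (r i)) <= 2 * B.
Proof.
move=> [r1 r2 _] h; rewrite sum_unit_difference mulr2n mulrDl mul1r.
by rewrite (le_trans (rnormB _ _))// lerD// h.
Qed.

(** The averaging bound for sums of coordinates says exactly that this functional has norm at most
    1. *)
Lemma mean_functional n (f : 'I_n.+1 -> nat) : injective f ->
  exists phi : {scalar E}, in_dual_ball phi /\
    forall x, phi x = r2s (fundamental E n.+1 / n.+1%:R) * \sum_i coord x (f i).
Proof.
move=> fi; pose g (x : E) : K := r2s (fundamental E n.+1 / n.+1%:R) * \sum_i coord x (f i).
have gl : linear_for *%R g.
  move=> a x y; rewrite /g (eq_bigr (fun i => a * coord x (f i) + coord y (f i))).
    by rewrite big_split -mulr_sumr mulrDr mulrCA.
  by move=> i _; rewrite coord_linear.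
pose phi : {scalar E} := HB.pack g (GRing.isLinear.Build _ _ _ _ g gl).
exists phi; split=> // x; rewrite /in_dual_ball /= /g ler_rnorm rnormM.
have F0 := ltW (fundamental_gt0 E n).
rewrite rnorm_scalar_of_real ger0_norm ?divr_ge0//.
rewrite mulrAC ler_pdivrMr// mulrC [leRHS]mulrC.
exact: rnorm_sum_coord_le.
Qed.

(** An upper P-estimate for vectors dualises to a Q-estimate for the values of a functional. The 2
    arises because a combination of differences is a difference of two embedded vectors. *)
Lemma functional_difference_powR n (r : 'I_n.+1 -> nat * nat) (phi : {scalar E})
    (P Q C : R) : 0 < P -> 0 < Q -> P^-1 + Q^-1 = 1 -> 0 < C ->
  (forall (f : 'I_n.+1 -> nat) v t, injective f -> 0 < t ->
     \sum_i rnorm (v i) `^ P <= n.+1%:R * t `^ P ->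
     rnorm (embed E f v) <= C * fundamental E n.+1 * t) ->
  disjoint_pairs r -> in_dual_ball phi ->
  \sum_i rnorm (phi (d E (r i))) `^ Q <=
    n.+1%:R * (2 * C * fundamental E n.+1 / n.+1%:R) `^ Q.
Proof.
move=> P0 Q0 PQ C0 hC hr hphi; have F0 := fundamental_gt0 E n.
apply: (dual_sum_powR P0 Q0 PQ) => [|w t t0 hw]; first by rewrite !mulr_gt0.
have := hphi (\sum_i w i *: d E (r i)); rewrite ler_rnorm => h.
rewrite (_ : \sum_i _ = phi (\sum_i w i *: d E (r i))); last first.
  by rewrite linear_sum; apply: eq_bigr => i _; rewrite linearZ.
apply: (le_trans h); rewrite -!mulrA; apply: sum_unit_difference_le => // f fi.
by rewrite mulrA; exact: hC.
Qed.

End OneSpace.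

Section TwoSpaces.
Context {E F : symmetric_sequence_space R k} {W : algebraic_tensor_product E F}.

Lemma finite_rank_matrix n (P : rel 'I_n) (a : 'I_n -> 'I_n -> K) x y :
  finite_rank (\sum_i \sum_(j | P i j) a i j *: tensor W (x i) (y j)).
Proof.
by apply: finite_rank_sum => i _; apply: finite_rank_sum => j _; exact: finite_rankZ.
Qed.

Lemma lift_matrix n (P : rel 'I_n) (a : 'I_n -> 'I_n -> K) x y (g : {linear W -> K^o}) :
  g (\sum_i \sum_(j | P i j) a i j *: tensor W (x i) (y j)) =
  \sum_i \sum_(j | P i j) a i j * g (tensor W (x i) (y j)) :> K.
Proof.
rewrite linear_sum; apply: eq_bigr => i _; rewrite linear_sum.
by apply: eq_bigr => j _; rewrite linearZ.
Qed.

Lemma concave_not_unconditional (p q P Q : R) (T : completion (@injective_norm R k E F W)) :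
  1 <= p <= P -> 1 <= q <= Q -> P^-1 + Q^-1 = 1 ->
  q_concave E p%:E -> q_concave F q%:E -> ~ embeds_in_unconditional T.
Proof.
move=> /andP[p1 pP] /andP[q1 qQ] PQ cE cF.
have P0 : 0 < P by rewrite (lt_le_trans _ pP)// (lt_le_trans _ p1).
have Q0 : 0 < Q by rewrite (lt_le_trans _ qQ)// (lt_le_trans _ q1).
have [CE CE0 hE] := q_concave_embed p1 pP cE.
have [CF CF0 hF] := q_concave_embed q1 qQ cF.
move=> /(triangle_tensor (@injective_norm_tensor _ _ _ _ W)) [C C0 tri].
(* The form at two functionals is at most 4 kappa CE CF L, which becomes L / (4 C). The triangle
   then has norm at most L / 4 + L / 4, against the lower bound L. *)
pose kappa := (16 * C * CE * CF)^-1.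
have k0 : 0 < kappa by rewrite invr_gt0 !mulr_gt0.
have QP : Q^-1 + P^-1 = 1 by rewrite addrC.
(* The exponents are exchanged because the form is evaluated at values of functionals, which are
   controlled in the dual exponents. *)
have [n [a [an abound]]] := @triangle_matrix R k Q P kappa Q0 P0 QP k0.
have FE0 := fundamental_gt0 E n; have FF0 := fundamental_gt0 F n.
have N0 : 0 < n.+1%:R :> R by [].
pose L := fundamental E n.+1 * fundamental F n.+1 / n.+1%:R.
have L0 : 0 < L by rewrite divr_gt0// mulr_gt0.
have L40 : 0 < L / 4 by rewrite divr_gt0.
have [r [c [hr hc h]]] := tri n.+1 (fun i j => r2s (a i j)) _ L40.
set u := \sum_(i < n.+1) \sum_(j < n.+1 | (i <= j)%N) _ in h.
set v := \sum_i \sum_j _ in h.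
have hv : injective_norm v <= L / (4 * C).
  apply: injective_norm_le; first exact: (finite_rank_matrix (fun _ _ => true)).
  move=> phi psi g bphi bpsi gE; rewrite (lift_matrix (fun _ _ => true)).
  have h1 := functional_difference_powR P0 Q0 PQ CE0 (hE n) hr bphi.
  have h2 := functional_difference_powR Q0 P0 QP CF0 (hF n) hc bpsi.
  have := abound _ _ _ _ _ _ h1 h2.
  rewrite !divr_gt0 ?mulr_gt0// => /(_ isT isT) h3.
  rewrite (eq_bigr (fun i => \sum_j r2s (a i j) * (phi (d E (r i)) * psi (d F (c j))))); last first.
    by move=> i _; apply: eq_bigr => j _; rewrite gE.
  apply: (le_trans h3); rewrite le_eqVlt; apply/orP; left; apply/eqP.
  by rewrite /kappa /L; field; rewrite !gt_eqF.
(* Each averaging functional reads only the positive coordinates of the differences and takes the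
   same value on all of them, so the pair multiplies the triangle sum, of modulus n + 1, by L / (n +
   1). *)
have hu : L <= injective_norm u.
  have [r1 _ _] := hr; have [c1 _ _] := hc.
  have [phi [bphi phiE]] := mean_functional E r1.
  have [psi [bpsi psiE]] := mean_functional F c1.
  have [g gE] := functional_tensor_lift W phi psi.
  have := injective_norm_ge (finite_rank_matrix _ _ _ _) bphi bpsi gE : rnorm (g u : K) <= _.
  apply: le_trans; rewrite /u (lift_matrix (fun i j => (i <= j)%N)).
  have sum1 (G : symmetric_sequence_space R k) (s : 'I_n.+1 -> nat * nat) i :
      disjoint_pairs s -> \sum_j coord (d G (s i)) (s j).1 = 1.
    move=> hs; rewrite (bigD1 i)//= coord_unit_difference// eqxx big1 ?addr0// => j ji.
    by rewrite coord_unit_difference// eq_sym (negbTE ji).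
  rewrite (_ : \sum_i _ = r2s (\sum_(i < n.+1) \sum_(j < n.+1 | (i <= j)%N) a i j) *
     (r2s (fundamental E n.+1 / n.+1%:R) * r2s (fundamental F n.+1 / n.+1%:R))).
    rewrite -!scalar_of_realM rnorm_scalar_of_real normrM an gtr0_norm ?mulr_gt0 ?divr_gt0//.
    by rewrite le_eqVlt; apply/orP; left; apply/eqP; rewrite /L; field; rewrite gt_eqF.
  rewrite scalar_of_real_sum mulr_suml; apply: eq_bigr => i _.
  rewrite scalar_of_real_sum mulr_suml; apply: eq_bigr => j _.
  by rewrite gE phiE psiE !sum1// !mulr1.
have := le_trans hu h; apply/negP; rewrite -ltNge.
apply: (@le_lt_trans _ _ (L / 4 + L / 4)); last by lra.
rewrite lerD2r (le_trans (ler_wpM2l (ltW C0) hv))//.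
by rewrite le_eqVlt; apply/orP; left; apply/eqP; field; rewrite gt_eqF.
Qed.

Lemma convex_not_unconditional (p q : \bar R) (P Q : R)
    (T : completion (@projective_norm R k E F W)) :
  (1 <= p)%E -> (1 <= q)%E -> 1 <= P -> 1 <= Q -> (P%:E <= p)%E -> (Q%:E <= q)%E ->
  P^-1 + Q^-1 = 1 -> p_convex E p -> p_convex F q -> ~ embeds_in_unconditional T.
Proof.
move=> p1 q1 P1 Q1 Pp Qq PQ cE cF.
have P0 : 0 < P := lt_le_trans ltr01 P1.
have Q0 : 0 < Q := lt_le_trans ltr01 Q1.
have [CE CE0 hE] := p_convex_coord p1 P1 Pp cE.
have [CF CF0 hF] := p_convex_coord q1 Q1 Qq cF.
move=> /(triangle_tensor (@projective_norm_tensor _ _ _ _ W)) [C C0 tri].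
(* Chosen so that [M] times the bound (4 C + 1) L for the triangle is (n + 1) / 2, whereas the form
   takes a value of modulus n + 1 there. *)
pose kappa := (2 * CE * CF * (4 * C + 1))^-1.
have C10 : 0 < 4 * C + 1 by rewrite addr_gt0// mulr_gt0.
have k0 : 0 < kappa by rewrite invr_gt0 !mulr_gt0.
have [n [a [an abound]]] := @triangle_matrix R k P Q kappa P0 Q0 PQ k0.
have FE0 := fundamental_gt0 E n; have FF0 := fundamental_gt0 F n.
have N0 : 0 < n.+1%:R :> R by [].
pose L := fundamental E n.+1 * fundamental F n.+1.
have L0 : 0 < L by rewrite mulr_gt0.
(* With all coefficients 1 the full tensor is elementary, so its projective norm is at most a
   product of two norms. *)
have [r [c [hr hc h]]] := tri n.+1 (fun _ _ => 1) _ L0.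
have [r1 _ _] := hr; have [c1 _ _] := hc.
set u := \sum_(i < n.+1) \sum_(j < n.+1 | (i <= j)%N) _ in h.
set v := \sum_i \sum_j _ in h.
have hv : projective_norm v <= 4 * L.
  rewrite (_ : v = tensor W (\sum_i 1 *: d E (r i)) (\sum_j 1 *: d F (c j))); last first.
    rewrite linear_sumlz; apply: eq_bigr => i _; rewrite linear_sumr; apply: eq_bigr => j _.
    by rewrite !scale1r.
  apply: (le_trans (projective_norm_tensor _ _ _)).
  rewrite (_ : 4 * L = (2 * fundamental E n.+1) * (2 * fundamental F n.+1)); last first.
    by rewrite /L; ring.
  by apply: ler_pM; rewrite ?rnorm_ge0//; apply: sum_unit_difference_le => // f fi;
     rewrite rnorm_embed_const// rnorm1 mul1r.
(* Reading only the first index of each pair gives this form the value [a i j] on the tensor of the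
   i-th and j-th differences. *)
pose f (x : E) (y : F) : K := \sum_i \sum_j r2s (a i j) * (coord x (r i).1 * coord y (c j).1).
have [||g gE] := @tensor_lift R k E F W f.
- move=> y e x x'; rewrite /f mulr_sumr -big_split; apply: eq_bigr => i _ /=.
  rewrite mulr_sumr -big_split; apply: eq_bigr => j _ /=; rewrite coord_linear; ring.
- move=> x e y y'; rewrite /f mulr_sumr -big_split; apply: eq_bigr => i _ /=.
  rewrite mulr_sumr -big_split; apply: eq_bigr => j _ /=; rewrite coord_linear; ring.
pose M := kappa * n.+1%:R * CE * CF / L.
have M0 : 0 < M by rewrite divr_gt0// !mulr_gt0.
have gM x y : rnorm (g (tensor W x y) : K) <= M * (rnorm x * rnorm y).
  have [->|x0] := eqVneq x 0; first by rewrite linear0l linear0 !rnorm0 mul0r mulr0.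
  have [->|y0] := eqVneq y 0; first by rewrite linear0r linear0 !rnorm0 !mulr0.
  have nx : 0 < rnorm x by rewrite rnorm_gt0.
  have ny : 0 < rnorm y by rewrite rnorm_gt0.
  rewrite gE; have := abound _ _ _ _ _ _ (hE n _ x r1 x0) (hF n _ y c1 y0).
  rewrite !divr_gt0 ?mulr_gt0// => /(_ isT isT) /le_trans; apply.
  rewrite le_eqVlt; apply/orP; left; apply/eqP.
  by rewrite /M /L; field; rewrite !gt_eqF.
have gu : g u = r2s (\sum_(i < n.+1) \sum_(j < n.+1 | (i <= j)%N) a i j) :> K.
  rewrite (lift_matrix (fun i j => (i <= j)%N)) scalar_of_real_sum; apply: eq_bigr => i _.
  rewrite scalar_of_real_sum; apply: eq_bigr => j _; rewrite gE mul1r /f.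
  rewrite (bigD1 i)//= [X in _ + X]big1 ?addr0 => [|i' ii']; last first.
    rewrite big1// => j' _; rewrite (coord_unit_difference E i i' hr).
    by rewrite eq_sym (negbTE ii') mul0r mulr0.
  rewrite (bigD1 j)//= [X in _ + X]big1 ?addr0 => [|j' jj']; last first.
    by rewrite (coord_unit_difference F j j' hc) eq_sym (negbTE jj') !mulr0.
  by rewrite !coord_unit_difference// !eqxx !mulr1.
have := projective_norm_ge (finite_rank_matrix _ _ _ _) M0 gM : rnorm (g u : K) <= _.
rewrite gu rnorm_scalar_of_real an => h1.
have h2 : projective_norm u <= (4 * C + 1) * L.
  by apply: (le_trans h); have := ler_wpM2l (ltW C0) hv; lra.
have h3 := le_trans h1 (ler_wpM2l (ltW M0) h2).
have E1 : M * ((4 * C + 1) * L) = n.+1%:R / 2.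
  by rewrite /M /kappa; field; rewrite !gt_eqF.
by move: h3; rewrite E1; lra.
Qed.

End TwoSpaces.
End Contradictions.

Theorem theorem6p5 (R : realType) (k : scalar_kind)
    (E F : symmetric_sequence_space R k) (p q : \bar R) :
  separable E -> separable F -> (1 <= p)%E -> (1 <= q)%E ->
  forall W : algebraic_tensor_product E F,
  (q_concave E p -> q_concave F q ->
   p <> +oo%E -> q <> +oo%E -> (q <= hoelder_conjugate p)%E ->
   forall T : completion (@injective_norm R k E F W),
   ~ embeds_in_unconditional T) /\
  (p_convex E p -> p_convex F q ->
   p <> 1%E -> q <> 1%E -> (hoelder_conjugate p <= q)%E ->
   forall T : completion (@projective_norm R k E F W),
   ~ embeds_in_unconditional T).
Proof.
move=> _ _ p1 q1 W; split=> [cE cF poo qoo pq T|cE cF pn1 qn1 pq T].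
  have [x [y [P [Q [px qy xP yQ [_ _ PQ]]]]]] := conjugate_above p1 q1 poo qoo pq.
  rewrite px in cE; rewrite qy in cF.
  exact: (concave_not_unconditional xP yQ PQ cE cF).
have [P [Q [Pp Qq P1 Q1 PQ]]] := conjugate_below p1 q1 pn1 qn1 pq.
exact: (convex_not_unconditional p1 q1 P1 Q1 Pp Qq PQ cE cF).
Qed.
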